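(* The function $Q(x,p_1,p_2,c_1,c_2,t)$ is quasi-universal in the Grzegorczyk class $\mathcal{E}^2$ with respect to the closure under superposition of the system of functions $$x+1,\quad xy,\quad \min(x,2^y),\quad x\dot- y,\quad [x/y],\quad [\log_2 x].$$
   Context: All functions are total on $\mathbb{N}_0$. Superposition means substitution, permutation and identification of variables, introduction of dummy variables. $x\dot- y=\max(x-y,0)$; $[x/y]$ is the integer part of $x/y$; $[\log_2 x]$ is the integer part of $\log_2 x$ for $x>0$ and $0$ for $x=0$; $x\wedge y$ is bitwise conjunction of binary representations. Grzegorczyk class $\mathcal{E}^2$: the smallest class containing $x+1$ and $f_2(x,y)=(x+1)(y+1)$ and closed under superposition and bounded recursion, where $f(\tilde x,y)$ is obtained from $g,h,j$ by bounded recursion if $f(\tilde x,0)=g(\tilde x)$, $f(\tilde x,y+1)=h(\tilde x,y,f(\tilde x,y))$ and $f(\tilde x,y)\le j(\tilde x,y)$. $R(x,y)$ is the cyclic shift of the binary representation of $x$ by $y$ digits to the right: $R(0,y)=0$, $R(1,y)=1$, and if $x\ge2$ has binary representation $a_na_{n-1}\dots a_0$ with $a_n=1$, then $R(x,y)$ has binary representation $a_{n+y}a_{n+y-1}\dots a_{1+y}a_y$, indices taken modulo $n+1$. $Q$ is defined by primitive recursion: $Q(x,p_1,p_2,c_1,c_2,0)=x$, and $Q(x,p_1,p_2,c_1,c_2,t+1)=Q(x,p_1,p_2,c_1,c_2,t)$ if $Q(x,p_1,p_2,c_1,c_2,t)\wedge R(p_1,c_1 t)\ne0$, and $Q(x,p_1,p_2,c_1,c_2,t+1)=Q(x,p_1,p_2,c_1,c_2,t)+R(p_2,c_2t)$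 otherwise. A function $Q(x_1,\dots,x_m)$ of $\mathcal{E}^2$ is quasi-universal in $\mathcal{E}^2$ with respect to a set of functions $\Phi$ if for every function $f(\tilde y)\in\mathcal{E}^2$ there exist functions $h(x,\tilde y),g_1(\tilde y),\dots,g_m(\tilde y)\in\Phi$ such that $f(\tilde y)=h(Q(g_1(\tilde y),\dots,g_m(\tilde y)),\tilde y)$ for all $\tilde y$. *)

(* Defs.v *)
From mathcomp Require Import all_boot.

Set Implicit Arguments.
Unset Strict Implicit.
Unset Printing Implicit Defensive.

Definition nfun (n : nat) := n.-tuple nat -> nat.

Definition fclass := forall n : nat, nfun n -> Prop.

Definition fun1 (F : nat -> nat) : nfun 1 := fun x => F (nth 0 x 0).

Definition fun2 (F : nat -> nat -> nat) : nfun 2 :=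
  fun x => F (nth 0 x 0) (nth 0 x 1).

Definition fun6 (F : nat -> nat -> nat -> nat -> nat -> nat -> nat) : nfun 6 :=
  fun x => F (nth 0 x 0) (nth 0 x 1) (nth 0 x 2)
             (nth 0 x 3) (nth 0 x 4) (nth 0 x 5).

(* Permuting or identifying variables and adding dummy variables amount to
   composing with projections; composition is substitution. The [_ext]
   constructors, here and below, identify pointwise equal functions. *)
Inductive superposition_closure (B : fclass) : fclass :=
| sup_base n (f : nfun n) :
    B n f -> superposition_closure B f
| sup_proj n (i : 'I_n) :
    superposition_closure B (fun x : n.-tuple nat => tnth x i)
| sup_comp m n (f : nfun m) (g : 'I_m -> nfun n) :
    superposition_closure B f ->
    (forall i, superposition_closure B (g i)) ->
    superposition_closure B (fun x : n.-tuple nat => f [tuple g i x | i < m])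
| sup_ext n (f g : nfun n) :
    f =1 g -> superposition_closure B f -> superposition_closure B g.

Definition bounded_recursion n (g : nfun n) (h : nfun n.+2) (j f : nfun n.+1) :=
  forall x : n.-tuple nat,
    f [tuple of rcons x 0] = g x /\
    forall y : nat,
      f [tuple of rcons x y.+1]
        = h [tuple of rcons (rcons x y) (f [tuple of rcons x y])] /\
      f [tuple of rcons x y] <= j [tuple of rcons x y].

(* The class has no member of arity 0. Recursion without parameters is still
   covered: add a dummy parameter, then identify it with the recursion
   variable. *)
Inductive E2 : fclass :=
| E2_succ : E2 (fun1 succn)
| E2_f2 : E2 (fun2 (fun x y => x.+1 * y.+1))
| E2_proj n (i : 'I_n) : E2 (fun x : n.-tuple nat => tnth x i)
| E2_comp m n (f : nfun m) (g : 'I_m -> nfun n) :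
    E2 f -> (forall i, E2 (g i)) ->
    E2 (fun x : n.-tuple nat => f [tuple g i x | i < m])
| E2_rec n (g : nfun n) (h : nfun n.+2) (j f : nfun n.+1) :
    E2 g -> E2 h -> E2 j -> bounded_recursion g h j f -> E2 f
| E2_ext n (f g : nfun n) : f =1 g -> E2 f -> E2 g.

(* [x %/ 0 = 0]. Under any other value of [x/0], this division is the
   superposition [x/y] * (1 - (1 - y)), so this convention gives the smallest
   closure. Also [trunc_log 2 0 = 0]. *)
Inductive arith_base : fclass :=
| base_succ : arith_base (fun1 succn)
| base_mul : arith_base (fun2 (fun x y => x * y))
| base_min_exp : arith_base (fun2 (fun x y => minn x (2 ^ y)))
| base_sub : arith_base (fun2 (fun x y => x - y))
| base_div : arith_base (fun2 (fun x y => x %/ y))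
| base_log : arith_base (fun1 (fun x => trunc_log 2 x)).

(* [trunc_log 2 x] is the index of the leading binary digit of [x]; the sum
   puts digit [(i + y) mod (trunc_log 2 x + 1)] of [x] at position [i]. *)
Definition R (x y : nat) : nat :=
  if x < 2 then x
  else \sum_(i < (trunc_log 2 x).+1)
         Nat.testbit x ((i + y) %% (trunc_log 2 x).+1) * 2 ^ i.

Fixpoint Q (x p1 p2 c1 c2 t : nat) : nat :=
  if t is t'.+1 then
    let q := Q x p1 p2 c1 c2 t' in
    if Nat.land q (R p1 (c1 * t')) != 0 then q else q + R p2 (c2 * t')
  else x.

Definition quasi_universal_E2 (Phi : fclass) m (q : nfun m) : Prop :=
  E2 q /\
  forall n (f : nfun n), E2 f ->
    exists (h : nfun n.+1) (g : 'I_m -> nfun n),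
      [/\ Phi n.+1 h, forall i, Phi n (g i) &
          forall y : n.-tuple nat,
            f y = h [tuple of q [tuple g i y | i < m] :: y]].

(* Main.v *)
Require Import Defs.
From Stdlib Require Import PeanoNat FunctionalExtensionality.
From mathcomp Require Import all_boot zify.

Set Implicit Arguments.
Unset Strict Implicit.
Unset Printing Implicit Defensive.

(* A function of E^2 is computed by a counter machine in polynomial time, hence
   with polynomially bounded counters. Write the counters and a one-hot,
   active-low program counter as base-[b] digits, [b] a power of 2. Then "a set
   of counters and a program position are all zero" means disjointness with a
   bit mask, and an instruction is a masked addition; a decrement is the
   addition of a negative number made positive by a multiple of a high, untested
   power of [b]. The [K] masks [M_i] and addends [A_i] are applied cyclically,
   whatever the current position in the program: those of inactive instructions
   do nothing. [Q] does this when the [M_i] and the [A_i] are laid out along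
   [p1] and [p2] in fields of widths [c1] and [c2], since the shifts by [c1 * t]
   and [c2 * t] bring field [t mod K] to the bottom. The other fields are
   harmless if one field of [p2] is wider than all of [p1]: the rest of [p2]
   only reaches positions above every mask, and below them only the bottom field
   of [p1] meets nonzero digits. All parameters are obtained by arithmetic from
   [b = 2 * min(N, 2^[log N])] with [N] a polynomial in the arguments, and the
   result, kept in counter 0, is the remainder modulo [b]. *)

(** * Rotations and masked additions *)

Lemma testbitE x i : Nat.testbit x i = odd (x %/ 2 ^ i).
Proof.
have div2E n : Nat.div2 n = n./2 /\ Nat.div2 n.+1 = n.+1./2.
  by elim: n => [//|n [IH1 IH2]]; split=> //=; rewrite IH1.
elim: i x => [|i IH] x.
  rewrite divn1 /=; elim: x => // n IH.
  by rewrite Nat.odd_succ -Nat.negb_odd IH.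
by rewrite /= IH (div2E x).1 expnS divnMA divn2.
Qed.

Lemma bits_inj a b : (forall i, odd (a %/ 2 ^ i) = odd (b %/ 2 ^ i)) -> a = b.
Proof. by move=> ab; apply: Nat.bits_inj => i; rewrite !testbitE. Qed.

Lemma land_eq0P a b :
  reflect (forall i, odd (a %/ 2 ^ i) && odd (b %/ 2 ^ i) = false)
          (Nat.land a b == 0).
Proof.
apply: (iffP eqP) => [ab0 i | ab0].
  by rewrite -!testbitE -Nat.land_spec ab0 Nat.bits_0.
by apply: Nat.bits_inj_0 => i; rewrite Nat.land_spec !testbitE.
Qed.

Lemma odd_modn_bit a m i :
  odd (a %% 2 ^ m %/ 2 ^ i) = (i < m) && odd (a %/ 2 ^ i).
Proof.
case: ltnP => [lt_im | le_mi] /=.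
  rewrite [in RHS](divn_eq a (2 ^ m)).
  have -> : 2 ^ m = 2 ^ (m - i.+1) * 2 * 2 ^ i.
    by rewrite -mulnA -expnS -expnD subnK.
  rewrite [in RHS]mulnA divnMDl ?expn_gt0 // oddD mulnA oddM.
  by rewrite andbF.
by rewrite divn_small // (leq_trans (ltn_pmod _ _)) ?expn_gt0 ?leq_exp2l.
Qed.

(** * Digits of numbers in base [B] *)

Lemma digits_recl B (X : nat -> nat) k :
  \sum_(i < k.+1) X i * B ^ i = X 0 + (\sum_(i < k) X i.+1 * B ^ i) * B.
Proof.
rewrite big_ord_recl /= muln1; congr (_ + _).
rewrite big_distrl /=; apply: eq_bigr => i _.
by rewrite -mulnA /bump /= add1n expnSr.
Qed.

Lemma digits_lt B (X : nat -> nat) k : (forall i, i < k -> X i < B) ->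
  \sum_(i < k) X i * B ^ i < B ^ k.
Proof.
elim: k X => [|k IH] X ltXB; first by rewrite big_ord0.
rewrite digits_recl expnSr.
have := IH (fun i => X i.+1) (fun i lt_ik => ltXB i.+1 lt_ik).
have := ltXB 0 isT; nia.
Qed.

(** The summand [B ^ k * c] stands for arbitrary contents above the first [k] digits; such contents
    pile up during the simulation. *)
Lemma digits_nth B (X : nat -> nat) c k j :
    (forall i, i < k -> X i < B) -> j < k ->
  (\sum_(i < k) X i * B ^ i + B ^ k * c) %/ B ^ j %% B = X j.
Proof.
elim: j k X => [|j IH] [//|k] X ltXB lt_jk.
  rewrite divn1 digits_recl expnSr mulnAC -addnA -mulnDl addnC modnMDl modn_small //.
  exact: ltXB.
rewrite digits_recl [B ^ j.+1]expnS divnMA [B ^ k.+1]expnSr mulnAC -addnA -mulnDl.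
have X0 := ltXB 0 isT.
rewrite addnC divnMDl; last by lia.
rewrite (divn_small X0) addn0.
by rewrite (IH k (fun i => X i.+1)) // => i lt_ik; apply: ltXB.
Qed.

Lemma digits_bit l (X : nat -> nat) c k u :
    0 < l -> (forall i, i < k -> X i < 2 ^ l) -> u < l * k ->
  odd ((\sum_(i < k) X i * (2 ^ l) ^ i + (2 ^ l) ^ k * c) %/ 2 ^ u) =
  odd (X (u %/ l) %/ 2 ^ (u %% l)).
Proof.
move=> l0 ltX ltu.
rewrite -(@digits_nth (2 ^ l) X c k (u %/ l)) //; last first.
  by rewrite ltn_divLR // mulnC.
rewrite odd_modn_bit ltn_mod l0 /= -divnMA -(expnM 2 l (u %/ l)) -expnD.
by rewrite [l * _]mulnC -divn_eq.
Qed.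

Lemma bits_sum (beta : nat -> bool) k j :
  odd ((\sum_(i < k) beta i * 2 ^ i) %/ 2 ^ j) = (j < k) && beta j.
Proof.
have beta_lt i : i < k -> beta i < 2 ^ 1 by case: (beta i).
case: ltnP => [lt_jk | le_kj] /=; last first.
  rewrite divn_small //; apply: leq_trans (digits_lt beta_lt) _.
  by rewrite leq_exp2l.
have := @digits_bit 1 _ 0 k _ isT beta_lt; rewrite mul1n => /(_ j lt_jk).
by rewrite muln0 addn0 divn1 modn1 expn1 divn1 => ->; case: (beta j).
Qed.

Lemma R_bit x L y i : 0 < L -> 2 ^ L.-1 <= x < 2 ^ L ->
  odd (R x y %/ 2 ^ i) = (i < L) && odd (x %/ 2 ^ ((i + y) %% L)).
Proof.
move=> L0 xL.
have logx : trunc_log 2 x = L.-1 by apply: trunc_log_eq; rewrite ?prednK.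
rewrite /R; case: ltnP => [x2 | _]; last first.
  rewrite logx prednK //.
  rewrite (bits_sum (fun i => Nat.testbit x ((i + y) %% L))).
  by rewrite testbitE.
(* The lower bound excludes [x = 0]; what remains is the single digit 1, fixed by every rotation. *)
have [x1 L1] : x = 1 /\ L = 1.
  move: xL; case/andP => Lx xL.
  case: L L0 Lx xL {logx} => [//|[|L]] _ /=; first by rewrite expn1; lia.
  have := expn_gt0 2 L; rewrite !expnS; lia.
rewrite x1 L1 modn1 ltnS leqn0; case: i => [|i] //=.
by rewrite divn_small // -{1}(expn0 2) ltn_exp2l.
Qed.

Lemma R_lt x L y : 0 < L -> 2 ^ L.-1 <= x < 2 ^ L -> R x y < 2 ^ L.
Proof.
move=> L0 xL; suff <- : R x y %% 2 ^ L = R x y by rewrite ltn_mod expn_gt0.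
apply: bits_inj => i; rewrite odd_modn_bit (R_bit _ _ L0 xL).
by case: ltnP.
Qed.

(* The digit [2 ^ W.-1] added at the top forces the binary length [W * K]
   on which [R] rotates. *)
Definition tape W K (X : nat -> nat) :=
  \sum_(i < K) (X i + (i == K.-1 :> nat) * 2 ^ W.-1) * (2 ^ W) ^ i.

Lemma tape_digit_lt W (X : nat -> nat) (b : bool) i : 0 < W -> X i < 2 ^ W.-1 ->
  X i + b * 2 ^ W.-1 < 2 ^ W.
Proof. by case: W => // W _ /=; rewrite expnS; case: b; lia. Qed.

Lemma tape_bounds W K X : 0 < W -> 0 < K ->
    (forall i, i < K -> X i < 2 ^ W.-1) ->
  2 ^ (W * K).-1 <= tape W K X < 2 ^ (W * K).
Proof.
move=> W0 K0 ltX; apply/andP; split; last first.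
  rewrite expnM.
  apply: (@digits_lt _ (fun i => X i + (i == K.-1) * 2 ^ W.-1)) => i lt_iK.
  exact/tape_digit_lt/ltX.
case: K K0 ltX => // K _ ltX; rewrite /tape big_ord_recr /= eqxx mul1n.
apply: leq_trans (leq_addl _ _); rewrite mulnDl.
apply: leq_trans (leq_addl _ _); rewrite -expnM -expnD leq_exp2l //; nia.
Qed.

(** Positions are read modulo [W * K], so a rotation by [W * t] brings field [t %% K] to the bottom.
    The remainder drops the other fields and the marker digit at height [W.-1]. *)
Lemma R_tape W K X t : 0 < W -> 0 < K ->
    (forall i, i < K -> X i < 2 ^ W.-1) ->
  R (tape W K X) (W * t) %% 2 ^ W.-1 = X (t %% K).
Proof.
move=> W0 K0 ltX; apply: bits_inj => i.
have tK : t %% K < K by rewrite ltn_mod.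
rewrite -[X _](modn_small (ltX _ tK)) !odd_modn_bit.
case: ltnP => //= lt_iW.
have WK0 : 0 < W * K by rewrite muln_gt0 W0.
rewrite (R_bit _ _ WK0 (tape_bounds W0 K0 ltX)).
have -> : (i + W * t) %% (W * K) = i + W * (t %% K).
  rewrite {1}(divn_eq t K) mulnDr mulnCA addnCA modnMDl modn_small //; nia.
have -> /= : i < W * K by nia.
have digit_lt j : j < K -> X j + (j == K.-1) * 2 ^ W.-1 < 2 ^ W.
  by move=> lt_jK; exact/tape_digit_lt/ltX.
have := @digits_bit _ _ 0 _ (i + W * (t %% K)) W0 digit_lt.
rewrite muln0 addn0 => -> /=; last nia.
have -> : (i + W * (t %% K)) %/ W = t %% K.
  by rewrite addnC mulnC divnMDl // divn_small ?addn0 //; lia.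
have -> : (i + W * (t %% K)) %% W = i.
  by rewrite addnC mulnC modnMDl modn_small //; lia.
have := odd_modn_bit (X (t %% K) + (t %% K == K.-1) * 2 ^ W.-1) W.-1 i.
by rewrite lt_iW addnC modnMDl odd_modn_bit lt_iW /= addnC => ->.
Qed.

(** This is [Q] with explicit sequences of masks and addends in place of rotations. *)
Fixpoint masked_run (M A : nat -> nat) x t :=
  if t is t'.+1 then
    let q := masked_run M A x t' in
    if Nat.land q (M t') != 0 then q else q + A t'
  else x.

Lemma masked_run_le M A x a t : (forall i, A i <= a) ->
  masked_run M A x t <= x + t * a.
Proof.
move=> leA; elim: t => [|t IH] /=; first lia.
have := leA t; case: ifP => _; lia.
Qed.

(** The invariant is agreement modulo [2 ^ W2.-1]. Rotated masks stay below [2 ^ (W1 * K)], hence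
    never reach the bits where [Q] and the run may differ. *)
Lemma Q_masked_run W1 W2 K M A x T : 0 < W1 -> 0 < K -> W1 * K < W2 ->
    (forall i, i < K -> M i < 2 ^ W1.-1) ->
    (forall i, i < K -> A i < 2 ^ W2.-1) ->
    let run t := masked_run (fun t => M (t %% K)) (fun t => A (t %% K)) x t in
    (forall t, t <= T -> run t < 2 ^ W1.-1) ->
  Q x (tape W1 K M) (tape W2 K A) W1 W2 T %% 2 ^ W2.-1 = run T.
Proof.
move=> W10 K0 W12 ltM ltA run lt_run.
have W20 : 0 < W2 by lia.
have le_W12 : W1 <= W2 by nia.
have le_W12' : W1.-1 <= W2.-1 by lia.
have lt_run2 t : t <= T -> run t < 2 ^ W2.-1.
  by move=> /lt_run lt; apply: leq_trans lt _; rewrite leq_exp2l //; lia.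
elim: T lt_run lt_run2 => [|t IH] lt_run lt_run2.
  by rewrite /= modn_small // (lt_run2 0).
have /IH {IH} : forall t0, t0 <= t -> run t0 < 2 ^ W1.-1.
  by move=> u le_ut; apply: lt_run; lia.
have {}lt_run2' : forall t0, t0 <= t -> run t0 < 2 ^ W2.-1.
  by move=> u le_ut; apply: lt_run2; lia.
move=> /(_ lt_run2') /=; set q := Q _ _ _ _ _ _ => IH.
set R1 := R _ _; set R2 := R _ _.
have R1mod : R1 %% 2 ^ W1.-1 = M (t %% K) by exact: R_tape.
have R1lt : R1 < 2 ^ W2.-1.
  apply: leq_trans (R_lt _ _ (tape_bounds W10 K0 ltM)) _; first nia.
  by rewrite leq_exp2l //; lia.
have -> : (Nat.land q R1 == 0) = (Nat.land (run t) (M (t %% K)) == 0).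
  (* Below [W2.-1], [q] and [run t] have the same bits; from there on [R1] has none. Between [W1.-1]
     and [W2.-1] the foreign fields of [R1] meet only zeros of [run t]. *)
  suff bits i : odd (q %/ 2 ^ i) && odd (R1 %/ 2 ^ i) =
      odd (run t %/ 2 ^ i) && odd (M (t %% K) %/ 2 ^ i).
    by apply/land_eq0P/land_eq0P => h i; have := h i; rewrite bits.
  have low : odd (run t %/ 2 ^ i) = (i < W2.-1) && odd (q %/ 2 ^ i).
    by rewrite -IH odd_modn_bit.
  have high : odd (R1 %/ 2 ^ i) = (i < W2.-1) && odd (R1 %/ 2 ^ i).
    by rewrite -{1}(modn_small R1lt) odd_modn_bit.
  have mask : odd (M (t %% K) %/ 2 ^ i) = (i < W1.-1) && odd (R1 %/ 2 ^ i).
    by rewrite -R1mod odd_modn_bit.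
  rewrite mask; case: ltnP => [lt_iW1|le_W1i] /=.
    by rewrite low (leq_trans lt_iW1 le_W12').
  rewrite andbF high andbA [_ && (i < _)]andbC -low divn_small //.
  by apply: leq_trans (lt_run t _) _; rewrite ?leq_exp2l.
have runS : run t.+1 = if Nat.land (run t) (M (t %% K)) != 0 then run t
  else run t + A (t %% K) by [].
move: runS; case: ifP => _ runS; first by rewrite IH runS.
have R2mod : R2 %% 2 ^ W2.-1 = A (t %% K) by exact: R_tape.
by rewrite -modnDm IH R2mod -runS modn_small // lt_run2.
Qed.

(** * Counter machines as masked additions *)

Definition upd (s : nat -> nat) r v : nat -> nat :=
  fun k => if k == r then v else s k.

Inductive instr := Inc of nat & nat | Dec of nat & nat & nat.

Definition config := (nat * (nat -> nat))%type.

Definition exec I (s : nat -> nat) : config :=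
  match I with
  | Inc r d => (d, upd s r (s r).+1)
  | Dec r z d => if s r == 0 then (z, s) else (d, upd s r (s r).-1)
  end.

Definition fetch L i := nth (Inc 0 0) L i.

Definition fire L i (c : config) :=
  if c.1 == i then exec (fetch L i) c.2 else c.

Definition istep L (c : config) :=
  if c.1 < size L then exec (fetch L c.1) c.2 else c.

(** Instructions are offered in cyclic order, just as the tapes offer their fields to [Q]. *)
Fixpoint scan L c t :=
  if t is t'.+1 then fire L (t' %% size L) (scan L c t') else c.

Lemma iter_step_halt L c t m : size L <= (iter t (istep L) c).1 ->
  t <= m -> iter m (istep L) c = iter t (istep L) c.
Proof.
move=> halt /subnKC <-; elim: (m - t) => [|k IH]; first by rewrite addn0.
by rewrite addnS /= IH /istep ltnNge halt.
Qed.

(** A full sweep meets the current instruction somewhere, so it performs at least one machine step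
    unless the machine has halted. *)
Lemma scan_iter L c t : 0 < size L ->
  exists2 m, t %/ size L <= m & scan L c t = iter m (istep L) c.
Proof.
move=> L0.
(* The last clause strengthens the induction: either the current sweep has already made its step, or
   the program counter has not been passed yet. *)
suff [m []] : exists m, [/\ t %/ size L <= m, scan L c t = iter m (istep L) c
    & t %/ size L < m \/ t %% size L <= (scan L c t).1].
  by exists m.
elim: t => [|t [m [le_m eq_scan later]]].
  by exists 0; rewrite div0n mod0n; split=> //; right.
have tmod := ltn_pmod t L0.
have [m' [m'1 m'2 m'3]] : exists m',
    [/\ t %/ size L <= m', scan L c t.+1 = iter m' (istep L) c
    & t %/ size L < m' \/ (t %% size L).+1 <= (scan L c t.+1).1].
  rewrite /= /fire; case: eqP => [pc|pc].
    exists m.+1; split; [lia | | by left].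
    by rewrite iterS -eq_scan /istep pc tmod.
  by exists m; split=> //; case: later => later; [left | right; lia].
have tS : t.+1 = t %/ size L * size L + (t %% size L).+1.
  by rewrite addnS -divn_eq.
have [lt_t | ge_t] := ltnP (t %% size L).+1 (size L).
  rewrite [in t.+1 %/ _]tS [in t.+1 %% _]tS divnMDl // (divn_small lt_t) addn0.
  by rewrite modnMDl modn_small //; exists m'.
have tL : (t %% size L).+1 = size L by lia.
rewrite [in t.+1 %/ _]tS [in t.+1 %% _]tS tL divnMDl // divnn L0 addn1.
rewrite modnMDl modnn.
(* A sweep without a step ends with the program counter outside the program; one more [istep] is
   then idle and may be counted. *)
case: m'3 => [lt_m'|halt]; first by exists m'; split=> //; right.
exists m'.+1; split; [lia | | by right].
by rewrite iterS -m'2 /istep ltnNge -tL halt.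
Qed.

(** A digit is disjoint from the all-ones digit only if it is zero. The mask ends below
    [(2 ^ l) ^ n], so [c] is invisible to it. *)
Lemma land_mask l n (X : nat -> nat) c (g : nat -> bool) : 0 < l ->
    (forall k, k < n -> X k < 2 ^ l) ->
  reflect (forall k, k < n -> g k -> X k = 0)
    (Nat.land (\sum_(k < n) X k * (2 ^ l) ^ k + (2 ^ l) ^ n * c)
              (\sum_(k < n) g k * (2 ^ l).-1 * (2 ^ l) ^ k) == 0).
Proof.
move=> l0 ltX.
have g_lt k : k < n -> g k * (2 ^ l).-1 < 2 ^ l.
  by move=> _; have := expn_gt0 2 l; case: (g k); lia.
have bit_ones i : i < l -> odd ((2 ^ l).-1 %/ 2 ^ i).
  move=> lt_il; have := bits_sum (fun=> true) l i; rewrite lt_il predn_exp.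
  by under eq_bigr do rewrite mul1n; rewrite mul1n => ->.
apply: (iffP (land_eq0P _ _)) => [disj k lt_kn gk | X0 u].
  apply: bits_inj => i; rewrite div0n.
  have [lt_il | le_li] := ltnP i l; last first.
    rewrite divn_small //; apply: leq_trans (ltX k lt_kn) _.
    by rewrite leq_exp2l.
  have lt_u : l * k + i < l * n by nia.
  have := disj (l * k + i); rewrite (digits_bit c l0 ltX lt_u).
  have := digits_bit 0 l0 g_lt lt_u; rewrite muln0 addn0 => ->.
  have -> : (l * k + i) %/ l = k.
    by rewrite mulnC divnMDl // divn_small ?addn0.
  have -> : (l * k + i) %% l = i by rewrite mulnC modnMDl modn_small.
  by rewrite gk mul1n bit_ones // andbT.
have [lt_u | le_u] := ltnP u (l * n); last first.
  rewrite [X in _ && odd X]divn_small ?andbF //.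
  apply: leq_trans (digits_lt g_lt) _; rewrite -expnM leq_exp2l //.
rewrite (digits_bit c l0 ltX lt_u).
have := digits_bit 0 l0 g_lt lt_u; rewrite muln0 addn0 => ->.
case gk: (g _); last by rewrite mul0n div0n andbF.
by rewrite X0 ?div0n // ltn_divLR // mulnC.
Qed.

Section Encoding.

Variables (nr : nat) (L : seq instr) (l : nat).

Let b := 2 ^ l.

(** The extra digit belongs to the halting position [size L]. *)
Definition width := nr + (size L).+1.

(* The program counter is one-hot and active low, so that one zero test covers
   both the position in the program and the tested register. *)
Definition reg (c : config) k : nat :=
  if k < nr then c.2 k else c.1 != k - nr.

Definition enc c := \sum_(k < width) reg c k * b ^ k.

(* Rules [2 * i] and [2 * i + 1] implement instruction [i]. The second one, a
   decrement, is reached with position [i] still active only if the zero test of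
   the first one failed. *)
Definition guard e k :=
  (k == nr + e./2) ||
  (if fetch L e./2 is Dec r _ _ then ~~ odd e && (k == r) else false).

Definition test_mask e := \sum_(k < width) guard e k * b.-1 * b ^ k.

(* The multiples of [b ^ width] keep the addend nonnegative and are never
   tested. *)
Definition addend e :=
  match fetch L e./2 with
  | Inc r d =>
      if odd e then 0 else b ^ width + b ^ r + b ^ (nr + e./2) - b ^ (nr + d)
  | Dec r z d =>
      if odd e then b ^ width + b ^ (nr + e./2) - b ^ (nr + d) - b ^ r
      else b ^ width + b ^ (nr + e./2) - b ^ (nr + z)
  end.

(** If [z = i], a successful zero test would leave position [i] active and the second rule would
    decrement a zero register. *)
Definition wf_instr i I :=
  match I with
  | Inc r d => (r < nr) && (d <= size L)
  | Dec r z d => [&& r < nr, z <= size L, d <= size L & z != i]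
  end.

Hypothesis l_gt0 : 0 < l.

Let b_gt1 : 1 < b.
Proof. by rewrite -(expn0 2) ltn_exp2l. Qed.

Lemma sum_delta d n : d < n -> \sum_(k < n) (k == d :> nat) * b ^ k = b ^ d.
Proof.
move=> lt_dn; rewrite (bigD1 (Ordinal lt_dn)) //= eqxx mul1n big1 ?addn0 //.
by move=> k /eqP neq; case: eqP => // eq; case: neq; apply: val_inj.
Qed.

(** The digit of the position left rises from 0 to 1 and that of the position entered falls from 1
    to 0. Adding on both sides avoids truncated subtraction. *)
Lemma enc_jump i d s : i <= size L -> d <= size L ->
  enc (d, s) + b ^ (nr + d) = enc (i, s) + b ^ (nr + i).
Proof.
move=> le_i le_d.
rewrite -(@sum_delta (nr + d) width) ?ltn_add2l // /enc.
rewrite -(@sum_delta (nr + i) width) ?ltn_add2l // -!big_split /=.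
apply: eq_bigr => k _; rewrite -!mulnDl; congr (_ * _).
by rewrite /reg /=; case: ltnP => ?; lia.
Qed.

Lemma enc_upd p s r v : r < nr ->
  enc (p, upd s r v) + s r * b ^ r = enc (p, s) + v * b ^ r.
Proof.
move=> lt_r; have lt_rw : r < width by rewrite /width; lia.
rewrite -(@sum_delta r width) // !big_distrr -!big_split /=.
apply: eq_bigr => k _; rewrite !mulnA -!mulnDl; congr (_ * _).
by rewrite /reg /= /upd; case: eqP => [->|_]; rewrite ?lt_r; lia.
Qed.

Definition rule e q := if Nat.land q (test_mask e) != 0 then q else q + addend e.

Lemma guardP e c m : (forall k, k < nr -> c.2 k < b) ->
  reflect (forall k, k < width -> guard e k -> reg c k = 0)
    (Nat.land (enc c + b ^ width * m) (test_mask e) == 0).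
Proof.
move=> data; apply: (land_mask _ _ l_gt0) => k _.
by rewrite /reg; case: ifP => [/data //|_]; case: (_ != _); rewrite // ltnW.
Qed.

Lemma rule_pair i c m : i < size L -> wf_instr i (fetch L i) ->
    (forall k, k < nr -> c.2 k < b) ->
  exists m', rule i.*2.+1 (rule i.*2 (enc c + b ^ width * m)) =
    enc (fire L i c) + b ^ width * m'.
Proof.
move=> lt_i wf data.
have half0 : i.*2./2 = i by rewrite doubleK.
have half1 : i.*2.+1./2 = i by rewrite /= uphalf_double.
have odd1 : odd i.*2.+1 by rewrite /= odd_double.
have odd0 : odd i.*2 = false by rewrite odd_double.
have pc_lt : nr + i < width by rewrite /width; lia.
(* While position [i] is inactive its digit is 1, and both rules of instruction [i] test it. *)
have idle e c' m' : e./2 = i -> c'.1 != i -> (forall k, k < nr -> c'.2 k < b) ->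
    rule e (enc c' + b ^ width * m') = enc c' + b ^ width * m'.
  move=> he pc data'; rewrite /rule; case: guardP => // /(_ _ pc_lt).
  by rewrite /guard he eqxx /reg ltnNge leq_addr addKn pc => /(_ isT).
rewrite /fire; case: eqP => [pc|/eqP pc]; last first.
  by exists m; rewrite !idle.
have pow_le d : d <= size L -> b ^ (nr + d) <= b ^ width.
  by move=> le_d; rewrite leq_exp2l // /width; lia.
case: c pc data => p s /= -> {p} data.
case E: (fetch L i) wf => [r d|r z d] /=.
  case/andP => lt_r le_d; exists m.+1.
  have -> q : rule i.*2.+1 q = q.
    by rewrite /rule /addend half1 E odd1 addn0 if_same.
  rewrite /rule; case: guardP => // [_|[]]; last first.
    move=> k _; rewrite /guard half0 E orbF => /eqP ->.
    by rewrite /reg ltnNge leq_addr addKn eqxx.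
  rewrite /addend half0 E odd0 /=.
  have := enc_jump (upd s r (s r).+1) (ltnW lt_i) le_d.
  have := enc_upd i s (s r).+1 lt_r.
  have := pow_le d le_d; rewrite mulSn mulnS; lia.
case/and4P => lt_r le_z le_d neq_zi; case: eqP => [sr0|/eqP sr].
  (* Zero register: the first rule jumps to [z], and since [z != i] the second one finds position
     [i] inactive. *)
  exists m.+1.
  have -> : rule i.*2 (enc (i, s) + b ^ width * m) =
      enc (z, s) + b ^ width * m.+1.
    rewrite /rule; case: guardP => // [_|[]]; last first.
      move=> k _; rewrite /guard half0 E odd0 => /orP[/eqP ->|/eqP ->].
        by rewrite /reg ltnNge leq_addr addKn eqxx.
      by rewrite /reg lt_r.
    rewrite /addend half0 E odd0 /=.
    have := enc_jump s (ltnW lt_i) le_z; have := pow_le z le_z.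
    rewrite mulnS; lia.
  by rewrite idle.
(* Nonzero register: it blocks the first rule, so the second one decrements. *)
exists m.+1.
have -> : rule i.*2 (enc (i, s) + b ^ width * m) = enc (i, s) + b ^ width * m.
  rewrite /rule; case: guardP => // /(_ r).
  rewrite /guard half0 E odd0 eqxx orbT /reg lt_r /= => /(_ _ isT) sr0.
  by rewrite sr0 // in sr; rewrite /width; lia.
rewrite /rule; case: guardP => // [_|[]]; last first.
  move=> k _; rewrite /guard half1 E odd1 orbF => /eqP ->.
  by rewrite /reg ltnNge leq_addr addKn eqxx.
rewrite /addend half1 E odd1 /=.
have := enc_jump (upd s r (s r).-1) (ltnW lt_i) le_d.
have := enc_upd i s (s r).-1 lt_r.
(* The added [b ^ width] covers both subtracted powers, so nothing is truncated. *)
have : b ^ (nr + d) + b ^ r <= b ^ width.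
  rewrite /width addnS expnS.
  have : b ^ (nr + d) <= b ^ (nr + size L) by rewrite leq_exp2l // leq_add2l.
  have : b ^ r <= b ^ (nr + size L).
    by rewrite leq_exp2l // ltnW // (leq_trans lt_r) // leq_addr.
  nia.
have : s r * b ^ r = (s r).-1 * b ^ r + b ^ r by rewrite -mulSnr prednK ?lt0n.
rewrite mulnS; lia.
Qed.

Lemma scan_rules c t : 0 < size L ->
    (forall i, i < size L -> wf_instr i (fetch L i)) ->
    (forall u k, k < nr -> (scan L c u).2 k < b) ->
  exists m,
    masked_run (fun e => test_mask (e %% (size L).*2))
               (fun e => addend (e %% (size L).*2)) (enc c) t.*2 =
    enc (scan L c t) + b ^ width * m.
Proof.
move=> L0 wf data; elim: t => [|t [m IH]]; first by exists 0; rewrite muln0 addn0.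
have lt_t := ltn_pmod t L0.
have [m' step] := rule_pair m lt_t (wf _ lt_t) (data t).
exists m'; rewrite -step -IH doubleS /= /rule.
have -> : t.*2.+1 %% (size L).*2 = (t %% size L).*2.+1.
  rewrite {1}(divn_eq t (size L)) doubleD -addnS doubleMr modnMDl modn_small //.
  lia.
by rewrite -!muln2 muln_modl.
Qed.

End Encoding.

(** * Structured programs *)

Inductive prog :=
| PInc of nat
| PClr of nat
| PSeq of prog & prog
| PLoop of nat & prog.

Fixpoint psize p :=
  match p with
  | PInc _ | PClr _ => 1
  | PSeq p q => psize p + psize q
  | PLoop _ p => (psize p).+1
  end.

(** The code starts at address [a] and exits to address [x]. A clearing instruction repeats itself;
    a loop body exits to the test at [a]. *)
Fixpoint compile p a x :=
  match p with
  | PInc r => [:: Inc r x]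
  | PClr r => [:: Dec r x a]
  | PSeq p q => compile p a (a + psize p) ++ compile q (a + psize p) x
  | PLoop r p => Dec r x a.+1 :: compile p a.+1 a
  end.

Fixpoint pregs p :=
  match p with
  | PInc r | PClr r => r.+1
  | PSeq p q => maxn (pregs p) (pregs q)
  | PLoop r p => maxn r.+1 (pregs p)
  end.

(** The number is the exact count of machine steps of the compiled code, zero tests included. *)
Inductive run : prog -> (nat -> nat) -> nat -> (nat -> nat) -> Prop :=
| run_inc r s : run (PInc r) s 1 (upd s r (s r).+1)
| run_clr r s : run (PClr r) s (s r).+1 (upd s r 0)
| run_seq p q s t s' t' s'' : run p s t s' -> run q s' t' s'' ->
    run (PSeq p q) s (t + t') s''
| run_done r p s : s r = 0 -> run (PLoop r p) s 1 s
| run_loop r p s t s' t' s'' : 0 < s r -> run p (upd s r (s r).-1) t s' ->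
    run (PLoop r p) s' t' s'' -> run (PLoop r p) s (t + t').+1 s''.

Lemma size_compile p a x : size (compile p a x) = psize p.
Proof.
by elim: p a x => //= [p IHp q IHq|r p IH] a x; rewrite ?size_cat ?IHp ?IHq ?IH.
Qed.

Lemma psize_gt0 p : 0 < psize p.
Proof. by elim: p => //= p IHp q IHq; rewrite addn_gt0 IHp. Qed.

(** An exit outside the block keeps every zero branch away from its own address, and this condition
    passes to the subprograms. *)
Lemma compile_wf L nr p a x i : (x <= size L) -> a + psize p <= size L ->
    pregs p <= nr -> (x < a) || (a + psize p <= x) -> i < psize p ->
  wf_instr nr L (a + i) (fetch (compile p a x) i).
Proof.
elim: p a x i => [r|r|p IHp q IHq|r p IH] a x i /= x_le a_le regs_le out i_lt.
- by case: i i_lt => // _; rewrite /= regs_le.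
- case: i i_lt => // _; rewrite /= regs_le x_le addn0; lia.
- rewrite geq_max in regs_le; case/andP: regs_le => p_le q_le.
  have q0 := psize_gt0 q; have p0 := psize_gt0 p.
  rewrite /fetch nth_cat size_compile; case: ltnP => i_p.
    by apply: IHp; lia.
  have -> : a + i = a + psize p + (i - psize p) by lia.
  by apply: IHq => //; lia.
- rewrite geq_max in regs_le; case/andP: regs_le => r_lt p_le.
  have p0 := psize_gt0 p.
  case: i i_lt => [_|i i_lt] /=; first by rewrite r_lt x_le; lia.
  by rewrite -addSnnS; apply: IH => //; lia.
Qed.

(** Arbitrary code before and after the block lets the induction hypotheses apply to subprograms in
    place. *)
Lemma run_compile p s t s' : run p s t s' -> forall L pre post x,
  L = pre ++ compile p (size pre) x ++ post ->
  iter t (istep L) (size pre, s) = (x, s').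
Proof.
elim=> {p s t s'} [r s|r s|p q s t s' t' s'' _ IHp _ IHq|r p s sr0
                  |r p s t s' t' s'' sr _ IHp _ IH] L pre post x eL.
- by rewrite eL /= /istep /fetch size_cat /= nth_cat ltnn subnn -ltn_subLR ?subnn.
- have fetchL : fetch L (size pre) = Dec r x (size pre).
    by rewrite eL /fetch nth_cat ltnn subnn.
  have lt_L : size pre < size L by rewrite eL size_cat /=; lia.
  have step s0 : istep L (size pre, s0) = exec (Dec r x (size pre)) s0.
    by rewrite /istep /= lt_L fetchL.
  move E: (s r) => k; elim: k s E => [|k IH] s E.
    rewrite /= step /= E eqxx; congr pair; apply: functional_extensionality => j.
    by rewrite /upd; case: eqP => // ->.
  have execE : exec (Dec r x (size pre)) s = (size pre, upd s r k).
    by rewrite /= E.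
  rewrite iterSr step execE IH; last by rewrite /upd eqxx.
  congr pair; apply: functional_extensionality => j.
  by rewrite /upd; case: eqP.
- rewrite addnC iterD.
  rewrite (IHp _ _ (compile q (size pre + psize p) x ++ post)
             (size pre + psize p)); last first.
    by rewrite eL /= -catA.
  have := IHq L (pre ++ compile p (size pre) (size pre + psize p)) post x.
  by rewrite size_cat size_compile; apply; rewrite eL /= !catA.
- by rewrite eL /= /istep /fetch size_cat /= nth_cat ltnn subnn /= sr0 -ltn_subLR ?subnn.
- rewrite iterSr addnC iterD.
  have -> : istep L (size pre, s) =
      (size (rcons pre (Dec r x (size pre).+1)), upd s r (s r).-1).
    rewrite eL /= /istep /fetch size_cat /= nth_cat ltnn subnn /= size_rcons.
    by rewrite eqn0Ngt sr -ltn_subLR ?subnn.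
  rewrite (IHp _ _ post (size pre)); first exact: IH eL.
  by rewrite eL size_rcons cat_rcons.
Qed.

Lemma exec_growth I s k : (exec I s).2 k <= (s k).+1.
Proof.
have upd_le r v : v <= (s r).+1 -> upd s r v k <= (s k).+1.
  by rewrite /upd; case: (k =P r) => [->|].
case: I => [r d|r z d] /=; first exact: upd_le.
by case: ifP => _ //=; apply: upd_le; lia.
Qed.

(** Each step raises a register by at most one, so a time bound is also a bound on the registers,
    hence on the base needed. *)
Lemma iter_step_growth L c t k : (iter t (istep L) c).2 k <= c.2 k + t.
Proof.
elim: t => [|t IH]; first by rewrite addn0.
rewrite iterS {1}/istep addnS; case: ifP => _; last by lia.
exact: leq_trans (exec_growth _ _ _) _.
Qed.

(** [T] sweeps make at least [T] steps and a halted machine stays put, so any upper bound on the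
    running time will do for [T]. *)
Lemma scan_compile p s t s' : run p s t s' ->
  let L := compile p 0 (psize p) in
  (forall u k, (scan L (0, s) u).2 k <= s k + t) /\
  (forall T, t <= T -> scan L (0, s) (T * size L) = (size L, s')).
Proof.
move=> run_p L.
have L0 : 0 < size L by rewrite size_compile psize_gt0.
have final : iter t (istep L) (0, s) = (size L, s').
  rewrite size_compile.
  by apply: (run_compile run_p (pre := [::]) (post := [::])); rewrite cats0.
have halt m : t <= m -> iter m (istep L) (0, s) = (size L, s').
  by move=> le_tm; rewrite (iter_step_halt _ le_tm) final.
split=> [u k|T le_tT].
  have [m _ ->] := scan_iter (0, s) u L0.
  have [le_mt|/ltnW le_tm] := leqP m t; last first.
    by rewrite halt // -final; apply: (iter_step_growth L (0, s)).
  by have := iter_step_growth L (0, s) m k; rewrite /=; lia.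
have [m le_m ->] := scan_iter (0, s) (T * size L) L0.
by rewrite halt // (leq_trans le_tT) // -(mulnK T L0).
Qed.

(** * Polynomial-time computability of E^2 *)

(** Polynomials with natural coefficients are monotone, and available both in E^2 and by arithmetic
    superposition. *)
Inductive poly : (nat -> nat) -> Prop :=
| poly_const c : poly (fun=> c)
| poly_id : poly (fun s => s)
| poly_add p q : poly p -> poly q -> poly (fun s => p s + q s)
| poly_mul p q : poly p -> poly q -> poly (fun s => p s * q s).

Lemma poly_mono p x y : poly p -> x <= y -> p x <= p y.
Proof.
move=> poly_p le_xy; elim: poly_p => //= *; first exact: leq_add.
exact: leq_mul.
Qed.

Lemma poly_comp p q : poly p -> poly q -> poly (fun s => p (q s)).
Proof. by move=> + poly_q; elim=> //= *; constructor. Qed.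

Lemma poly_sum m (p : 'I_m -> nat -> nat) : (forall i, poly (p i)) ->
  poly (fun s => \sum_(i < m) p i s).
Proof.
elim: m p => [|m IH] p poly_p.
  have -> : (fun s => \sum_(i < 0) p i s) = fun=> 0.
    by apply: functional_extensionality => s; rewrite big_ord0.
  exact: poly_const.
have -> : (fun s => \sum_(i < m.+1) p i s) =
    fun s => p ord0 s + \sum_(i < m) p (lift ord0 i) s.
  by apply: functional_extensionality => s; rewrite big_ord_recl.
by apply: poly_add => //; apply: IH.
Qed.

Lemma sumn_mktuple m (F : 'I_m -> nat) :
  sumn [tuple F i | i < m] = \sum_(i < m) F i.
Proof.
by rewrite sumnE big_tuple; apply: eq_bigr => i _; rewrite tnth_mktuple.
Qed.

Lemma tuple_rconsP T n (x : n.+1.-tuple T) :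
  exists u a, x = [tuple of rcons (u : n.-tuple T) a].
Proof.
case: x => s; elim/last_ind: s => [//|s a _] sz.
have sz' : size s == n by rewrite size_rcons in sz.
by exists (Tuple sz'), a; apply: val_inj.
Qed.

(** A bounded recursion inherits the bound of its majorant [j]; under composition the monotone
    bounds compose. *)
Lemma E2_bound n (f : nfun n) : E2 f ->
  exists2 p, poly p & forall x, f x <= p (sumn x).
Proof.
elim=> {n f} [||n i|m n f g _ [p poly_p le_p] _ IHg
             |n g h j f _ _ _ _ _ [p poly_p le_p] rec
             |n f g fg _ [p poly_p le_p]].
- exists (fun s => s + 1); first by do !constructor.
  by case=> -[|a []] // sz; rewrite /fun1 /=; lia.
- exists (fun s => (s + 1) * (s + 1)); first by do !constructor.
  by case=> -[|a [|c []]] // sz; rewrite /fun2 /=; nia.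
- exists (fun s => s); first exact: poly_id.
  by move=> x; rewrite sumnE big_tuple (bigD1 i) //= leq_addr.
- have [q poly_q le_q] := fin_all_exists2 IHg.
  exists (fun s => p (\sum_(i < m) q i s)).
    exact/poly_comp/poly_sum.
  move=> x; apply: leq_trans (le_p _) _; rewrite sumn_mktuple.
  by apply: poly_mono => //; apply: leq_sum => i _; apply: le_q.
- exists p => // x; have [u [a ->]] := tuple_rconsP x.
  by apply: leq_trans (le_p _); have [_ /(_ a) []] := rec u.
- by exists p => // x; rewrite -fg.
Qed.

(** * Time-bounded runs of programs *)

Definition runs p s T s' := exists2 t, t <= T & run p s t s'.

Lemma runs_le p s T T' s' : runs p s T s' -> T <= T' -> runs p s T' s'.
Proof. by case=> t le_t run_p le_T; exists t => //; apply: leq_trans le_T. Qed.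

Lemma runs_seq p q s T s' T' s'' : runs p s T s' -> runs q s' T' s'' ->
  runs (PSeq p q) s (T + T') s''.
Proof.
case=> t le_t run_p [t' le_t' run_q]; exists (t + t'); first exact: leq_add.
exact: run_seq run_q.
Qed.

Lemma runs_inc r s s' : s' = upd s r (s r).+1 -> runs (PInc r) s 1 s'.
Proof. by move=> ->; exists 1 => //; apply: run_inc. Qed.

Lemma runs_clr r s s' : s' = upd s r 0 -> runs (PClr r) s (s r).+1 s'.
Proof. by move=> ->; exists (s r).+1 => //; apply: run_clr. Qed.

(** Programs have no empty statement; clearing a zero register serves as one. *)
Lemma runs_nop r s : s r = 0 -> runs (PClr r) s 1 s.
Proof.
move=> sr0; have <- : (s r).+1 = 1 by rewrite sr0.
apply: runs_clr; apply: functional_extensionality => j.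
by rewrite /upd; case: eqP => // ->.
Qed.

(** [sigma k] is the state after [k] passes. Each pass costs its body and one decrement; the final
    zero test costs one more. *)
Lemma runs_loop r p T N (sigma : nat -> nat -> nat) :
    (forall k, k <= N -> sigma k r = N - k) ->
    (forall k, k < N ->
       runs p (upd (sigma k) r (N - k).-1) T (sigma k.+1)) ->
  runs (PLoop r p) (sigma 0) (N * T.+1).+1 (sigma N).
Proof.
elim: N sigma => [|N IH] sigma sigma_r body.
  by exists 1 => //; apply: run_done; rewrite sigma_r.
have [t le_t run_p] := body 0 isT.
have [k le_k|k lt_k|t' le_t' run_l] := IH (fun k => sigma k.+1).
- by rewrite sigma_r.
- exact: (body k.+1).
exists (t + t').+1; first by lia.
have sr : sigma 0 r = N.+1 by rewrite sigma_r.
by apply: run_loop run_l; rewrite sr.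
Qed.

Ltac upd_eq :=
  apply: functional_extensionality => ?; rewrite /upd;
  repeat (case: eqP => ?); subst; try (exfalso; lia); try lia.

Definition pmove x y := PLoop x (PInc y).

Lemma runs_move x y s s' : x != y ->
    s' = upd (upd s y (s y + s x)) x 0 ->
  runs (pmove x y) s (s x * 2).+1 s'.
Proof.
move=> xy ->; pose sigma k := upd (upd s y (s y + k)) x (s x - k).
have -> : s = sigma 0 by rewrite /sigma; upd_eq.
have -> : sigma 0 x = s x by rewrite /sigma /upd eqxx subn0.
have -> : upd (upd (sigma 0) y (sigma 0 y + s x)) x 0 = sigma (s x).
  by rewrite /sigma; upd_eq.
apply: runs_loop => [k _|k lt_k]; first by rewrite /sigma /upd eqxx.
by apply: runs_inc; rewrite /sigma; upd_eq.
Qed.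

(** Looping over [x] destroys it, so a second copy is made in [tmp] and moved back. *)
Definition pcopy x y tmp :=
  PSeq (PLoop x (PSeq (PInc tmp) (PInc y))) (pmove tmp x).

Lemma runs_copy x y tmp s s' : x != y -> x != tmp -> y != tmp -> s tmp = 0 ->
    s' = upd s y (s y + s x) ->
  runs (pcopy x y tmp) s (s x * 5 + 2) s'.
Proof.
move=> xy xt yt st ->.
pose sigma k := upd (upd (upd s x (s x - k)) tmp k) y (s y + k).
have loop : runs (PLoop x (PSeq (PInc tmp) (PInc y))) (sigma 0)
    (s x * 3).+1 (sigma (s x)).
  apply: runs_loop => [k _|k lt_k].
    by rewrite /sigma /upd; repeat (case: eqP => ?); lia.
  apply: (@runs_seq _ _ _ 1 (upd (sigma k.+1) y (s y + k)) 1).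
    by apply: runs_inc; rewrite /sigma; upd_eq.
  by apply: runs_inc; rewrite /sigma; upd_eq.
have {1}-> : s = sigma 0 by rewrite /sigma; upd_eq.
apply: runs_le (runs_seq loop (runs_move _ _)) _.
- by rewrite eq_sym.
- by rewrite /sigma; upd_eq.
- by rewrite /sigma /upd; repeat (case: eqP => ?); lia.
Qed.

(** As only [out] changes, inputs survive and the scratch registers from [base] on are zero again
    for the next subprogram. The time bound is chosen before the register layout. *)
Definition computable n (f : nfun n) :=
  exists2 tau, poly tau &
  forall (ins : n.-tuple nat) out base,
    all (fun r => r < base) ins -> out < base -> out \notin ins ->
  exists p, forall s, (forall r, base <= r -> s r = 0) ->
    runs p s (tau (sumn (map_tuple s ins)))
      (upd s out (s out + f (map_tuple s ins))).

Lemma leq_sumn_tnth n (x : n.-tuple nat) i : tnth x i <= sumn x.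
Proof. by rewrite sumnE big_tuple (bigD1 i) //= leq_addr. Qed.

Lemma tnth_ins n (ins : n.-tuple nat) out base i :
    all (fun r => r < base) ins -> out \notin ins ->
  tnth ins i < base /\ tnth ins i != out.
Proof.
move=> /allP lt_ins out_ins; split; first exact/lt_ins/mem_tnth.
by apply: contraNneq out_ins => <-; apply: mem_tnth.
Qed.

Lemma computable_proj n (i : 'I_n) : computable (fun x : n.-tuple nat => tnth x i).
Proof.
exists (fun s => s * 5 + 2); first by do !constructor.
move=> ins out base lt_ins lt_out out_ins.
have [x_lt x_out] := tnth_ins i lt_ins out_ins.
exists (pcopy (tnth ins i) out base) => s s0.
have := leq_sumn_tnth (map_tuple s ins) i; rewrite tnth_map => le_sum.
have copy : runs (pcopy (tnth ins i) out base) s (s (tnth ins i) * 5 + 2)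
    (upd s out (s out + s (tnth ins i))).
  by apply: runs_copy => //; [lia | lia | apply: s0].
by apply: runs_le copy _; lia.
Qed.

Lemma computable_succ : computable (fun1 succn).
Proof.
have [tau poly_tau comp] := computable_proj (@ord0 0).
exists (fun s => tau s + 1); first by do !constructor.
move=> ins out base lt_ins lt_out out_ins.
have [p run_p] := comp ins out base lt_ins lt_out out_ins.
exists (PSeq p (PInc out)) => s s0.
apply: runs_seq (run_p s s0) _; apply: runs_inc.
rewrite /fun1 (tnth_nth 0) /=; upd_eq.
Qed.

Lemma computable_f2 : computable (fun2 (fun x y => x.+1 * y.+1)).
Proof.
exists (fun s => (s * 5 + 2) + 1 + ((s + 1) * ((s * 5 + 2) + 1 + 1) + 1)).
  by do !constructor.
move=> ins out base lt_ins lt_out out_ins.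
have [x_lt x_out] := tnth_ins ord0 lt_ins out_ins.
have [y_lt y_out] := tnth_ins ord_max lt_ins out_ins.
set x := tnth ins ord0 in x_lt x_out; set y := tnth ins ord_max in y_lt y_out.
exists (PSeq (PSeq (pcopy x base base.+1) (PInc base))
  (PLoop base (PSeq (pcopy y out base.+1) (PInc out)))) => s s0.
have sb := s0 base (leqnn _); have sb1 := s0 base.+1 (leqnSn _).
have := leq_sumn_tnth (map_tuple s ins) ord0; rewrite tnth_map -/x => le_x.
have := leq_sumn_tnth (map_tuple s ins) ord_max; rewrite tnth_map -/y => le_y.
have -> : fun2 (fun x y => x.+1 * y.+1) (map_tuple s ins) = (s x).+1 * (s y).+1.
  have nthE (i : 'I_2) : nth 0 (map_tuple s ins) i = s (tnth ins i).
      by rewrite -tnth_nth tnth_map.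
    by rewrite /fun2 (nthE ord0) (nthE ord_max).
move: (sumn _) le_x le_y => S le_x le_y.
(* Register [base] counts [x + 1] passes, each adding [y + 1] to [out]. *)
pose sigma k := upd (upd s base ((s x).+1 - k)) out (s out + k * (s y).+1).
have init : runs (PSeq (pcopy x base base.+1) (PInc base)) s (S * 5 + 2 + 1)
    (sigma 0).
  apply: (@runs_seq _ _ _ _ (upd s base (s x))).
    have copy : runs (pcopy x base base.+1) s (s x * 5 + 2) (upd s base (s x)).
      by apply: runs_copy; rewrite ?sb //; lia.
    by apply: runs_le copy _; lia.
  by apply: runs_inc; rewrite /sigma; upd_eq.
have loop : runs (PLoop base (PSeq (pcopy y out base.+1) (PInc out))) (sigma 0)
    ((s x).+1 * (S * 5 + 2 + 1).+1).+1 (sigma (s x).+1).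
  apply: runs_loop => [k _|k lt_k].
    by rewrite /sigma /upd; repeat (case: eqP => ?); lia.
  apply: (@runs_seq _ _ _ _ (upd (sigma k.+1) out (s out + k * (s y).+1 + s y))).
    set s1 := upd _ _ _.
    have s1y : s1 y = s y.
      by rewrite /s1 /sigma /upd; repeat (case: eqP => ?); lia.
    have copy : runs (pcopy y out base.+1) s1 (s1 y * 5 + 2)
       (upd (sigma k.+1) out (s out + k * (s y).+1 + s y)).
      apply: runs_copy => //; try lia.
        by rewrite /s1 /sigma /upd; repeat (case: eqP => ?); lia.
      by rewrite s1y /s1 /sigma; upd_eq.
    by apply: runs_le copy _; lia.
  by apply: runs_inc; rewrite /sigma; upd_eq; nia.
have <- : sigma (s x).+1 = upd s out (s out + (s x).+1 * (s y).+1).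
  by rewrite /sigma; upd_eq.
by apply: runs_le (runs_seq init loop) _; nia.
Qed.

(** Register [base + m], known to be zero, supplies the empty statement that starts the
    induction. *)
Lemma runs_clr_range base m :
  exists p, forall s, s (base + m) = 0 ->
    runs p s (1 + \sum_(i < m) (s (base + i)).+1)
      (fun r => if base <= r < base + m then 0 else s r).
Proof.
suff claim k : k <= m -> exists p, forall s, s (base + m) = 0 ->
    runs p s (1 + \sum_(i < k) (s (base + i)).+1)
      (fun r => if base <= r < base + k then 0 else s r) by exact: claim.
elim: k => [|k IH] le_km.
  exists (PClr (base + m)) => s sm; rewrite big_ord0.
  have -> : (fun r => if base <= r < base + 0 then 0 else s r) = s.
    by apply: functional_extensionality => r; case: ifP => //; lia.
  exact: runs_nop.
have [p run_p] := IH (ltnW le_km).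
exists (PSeq p (PClr (base + k))) => s sm.
rewrite big_ord_recr /= addnA; apply: runs_seq (run_p s sm) _.
set s1 := fun r => _.
have <- : s1 (base + k) = s (base + k) by rewrite /s1; case: ifP => //; lia.
apply: runs_clr; apply: functional_extensionality => r; rewrite /upd /s1.
by repeat case: ifP => ?; lia.
Qed.

Lemma map_ins n (ins : n.-tuple nat) (s s' : nat -> nat) :
  {in ins, s =1 s'} -> map_tuple s ins = map_tuple s' ins.
Proof. by move=> eq_s; apply/val_inj/eq_in_map. Qed.

(** The values of the [g i] are collected in registers [base + i], read there by [f], then cleared.
    Their polynomial bounds control the time of the last two phases. *)
Lemma computable_comp m n (f : nfun m) (g : 'I_m -> nfun n) :
    computable f -> (forall i, computable (g i)) ->
    (forall i, exists2 p, poly p & forall x, g i x <= p (sumn x)) ->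
  computable (fun x : n.-tuple nat => f [tuple g i x | i < m]).
Proof.
move=> [tauf poly_f comp_f] /fin_all_exists2[tau poly_tau comp_g].
move=> /fin_all_exists2[p poly_p le_p].
exists (fun S => (1 + \sum_(i < m) tau i S) + tauf (\sum_(i < m) p i S)
                 + (1 + \sum_(i < m) (p i S + 1))).
  have poly_sump := poly_sum poly_p.
  apply: poly_add; last first.
    apply: poly_add; first exact: poly_const.
    by apply: poly_sum => i; apply: poly_add => //; apply: poly_const.
  apply: poly_add; last exact: poly_comp.
  by apply: poly_add; [apply: poly_const | apply: poly_sum].
move=> ins out base lt_ins lt_out out_ins.
pose v s : m.-tuple nat := [tuple g i (map_tuple s ins) | i < m].
pose st s k r := if base <= r < base + k then nth 0 (v s) (r - base) else s r.
have [pg run_pg] : exists pg, forall s, (forall r, base <= r -> s r = 0) ->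
    runs pg s (1 + \sum_(i < m) tau i (sumn (map_tuple s ins))) (st s m).
  suff claim k (le_km : k <= m) : exists pg, forall s,
      (forall r, base <= r -> s r = 0) ->
      runs pg s (1 + \sum_(i < k) tau (widen_ord le_km i) (sumn (map_tuple s ins)))
        (st s k).
    have [pg run_pg] := claim m (leqnn m); exists pg => s s0.
    apply: runs_le (run_pg s s0) _; rewrite leq_add2l leq_eqVlt; apply/orP; left.
    apply/eqP/eq_bigr => i _; congr (tau _ _); exact: val_inj.
  elim: k le_km => [|k IH] le_km.
    exists (PClr base) => s s0; rewrite big_ord0.
    have -> : st s 0 = s.
      by apply: functional_extensionality => r; rewrite /st; case: ifP => //; lia.
    by apply: runs_nop; apply: s0.
  have [pg run_pg] := IH (ltnW le_km); pose i := Ordinal le_km.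
  (* The scratch space of [g i] starts at [base + m], above all the slots, so the values already
     stored are safe. *)
  have lt_ins' : all (fun r => r < base + m) ins.
    by apply: sub_all lt_ins => r; lia.
  have out_ins' : base + k \notin ins.
    by apply/negP => /(allP lt_ins); lia.
  have lt_out' : base + k < base + m by lia.
  have [q run_q] := comp_g i ins (base + k) (base + m) lt_ins' lt_out' out_ins'.
  exists (PSeq pg q) => s s0.
  have st_ins : map_tuple (st s k) ins = map_tuple s ins.
    by apply: map_ins => r /(allP lt_ins) lt_r; rewrite /st; case: ifP => //; lia.
  rewrite big_ord_recr /= addnA.
  have -> : widen_ord le_km ord_max = i by apply: val_inj.
  have q_ok r : base + m <= r -> st s k r = 0.
    by move=> le_r; rewrite /st; case: ifP => [|_]; [lia | apply: s0; lia].
  have := run_q (st s k) q_ok; rewrite st_ins => {}run_q.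
  have -> : st s k.+1 =
      upd (st s k) (base + k) (st s k (base + k) + g i (map_tuple s ins)).
    apply: functional_extensionality => r; rewrite /upd.
    case: eqP => [->|neq]; last by rewrite /st; repeat case: ifP => ?; lia.
    have -> : st s k (base + k) = 0.
      by rewrite /st; case: ifP => [|_]; [lia | apply: s0; lia].
    rewrite /st; case: ifP => [_|]; last by lia.
    by rewrite addKn -(tnth_nth 0 (v s) i) tnth_mktuple.
  apply: runs_seq run_q; apply: runs_le (run_pg s s0) _.
  rewrite leq_add2l leq_eqVlt; apply/orP; left.
  apply/eqP/eq_bigr => j _; congr (tau _ _); exact: val_inj.
pose ins2 : m.-tuple nat := [tuple base + i | i < m].
have lt_ins2 : all (fun r => r < base + m) ins2.
  by apply/allP => r /tnthP[i ->]; rewrite tnth_mktuple ltn_add2l.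
have out_ins2 : out \notin ins2.
  by apply/negP => /tnthP[i]; rewrite tnth_mktuple; lia.
have lt_out2 : out < base + m by lia.
have [pf run_pf] := comp_f ins2 out (base + m) lt_ins2 lt_out2 out_ins2.
have [pc run_pc] := runs_clr_range base m.
exists (PSeq (PSeq pg pf) pc) => s s0.
set S := sumn _.
have st_ins2 : map_tuple (st s m) ins2 = v s.
  apply: eq_from_tnth => i; rewrite tnth_map !tnth_mktuple /st.
  case: ifP => [_|]; last by have := ltn_ord i; lia.
  by rewrite addKn -(tnth_nth 0 (v s) i) tnth_mktuple.
have st0 r : base + m <= r -> st s m r = 0.
  by move=> le_r; rewrite /st; case: ifP => [|_]; [lia | apply: s0; lia].
have st_out : st s m out = s out by rewrite /st; case: ifP => //; lia.
have := run_pf _ st0; rewrite st_ins2 st_out; set s2 := upd _ _ _ => run_f.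
have s2m : s2 (base + m) = 0.
  by rewrite /s2 /upd; case: eqP => [|_]; [lia | apply: st0].
have s2v i : i < m -> s2 (base + i) = nth 0 (v s) i.
  move=> lt_im; rewrite /s2 /upd; case: eqP => [|_]; first lia.
  by rewrite /st; case: ifP => [_|]; [rewrite addKn | lia].
have le_v i : nth 0 (v s) i <= \sum_(j < m) (j == i :> nat) * p j S.
  have [lt_im|le_mi] := ltnP i m; last by rewrite nth_default ?size_tuple.
  rewrite (bigD1 (Ordinal lt_im)) //= eqxx mul1n.
  rewrite -(tnth_nth 0 (v s) (Ordinal lt_im)) tnth_mktuple.
  exact: leq_trans (le_p _ _) (leq_addr _ _).
have -> : upd s out (s out + f (v s)) =
    fun r => if base <= r < base + m then 0 else s2 r.
  apply: functional_extensionality => r; rewrite /s2 /upd.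
  case: eqP => [->|_]; case: ifP => //; try lia.
    by move=> in_r; apply: s0; lia.
  by rewrite /st => ->.
apply: runs_seq (runs_seq (run_pg s s0) _) _.
  apply: runs_le run_f _; apply: poly_mono => //; rewrite sumn_mktuple.
  by apply: leq_sum => i _; apply: le_p.
apply: runs_le (run_pc s2 s2m) _; rewrite leq_add2l; apply: leq_sum => i _.
rewrite s2v // -(tnth_nth 0 (v s) i) tnth_mktuple addn1 ltnS; exact: le_p.
Qed.

Lemma map_rcons_tuple n (u : n.-tuple nat) a (s : nat -> nat) :
  map_tuple s [tuple of rcons u a] = [tuple of rcons (map_tuple s u) (s a)].
Proof. by apply: val_inj; rewrite /= map_rcons. Qed.

(** All intermediate values are bounded by [p], so each call of [h] has inputs of polynomial size,
    and the recursion variable bounds the number of calls. *)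
Lemma computable_rec n (g : nfun n) (h : nfun n.+2) (j f : nfun n.+1) p :
    computable g -> computable h -> bounded_recursion g h j f ->
    poly p -> (forall x, f x <= p (sumn x)) ->
  computable f.
Proof.
move=> [taug poly_g comp_g] [tauh poly_h comp_h] rec poly_p le_p.
exists (fun S => (S * 5 + 2) + taug S
   + (S * (tauh (S + p S) + 3 * p S + 3 + 1) + 1) + (p S * 2 + 1) + (S + 1)).
  have polyS := poly_id; have polyhS : poly (fun S => tauh (S + p S)).
    by apply: poly_comp => //; apply: poly_add.
  by do ![exact: poly_const | exact: poly_id | done | apply: poly_add | apply: poly_mul].
move=> ins out base; have [xs [yr ->]] := tuple_rconsP ins.
rewrite all_rcons mem_rcons inE negb_or => /andP[lt_y lt_xs] lt_out.
case/andP => out_y out_xs.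
(* [c] counts the passes left and [i] those done; [v] holds the current value and [w] receives the
   next one. *)
pose c := base; pose i := base.+1; pose v := base.+2; pose w := base.+3.
have lt_xs' b : base <= b -> all (fun r => r < b) xs.
  by move=> le_b; apply: sub_all lt_xs => r; lia.
have new_xs b : base <= b -> b \notin xs.
  by move=> le_b; apply/negP => /(allP lt_xs); lia.
have [pg run_pg] : exists pg, forall s, (forall r, base.+4 <= r -> s r = 0) ->
    runs pg s (taug (sumn (map_tuple s xs))) (upd s v (s v + g (map_tuple s xs))).
  by apply: comp_g; [apply: lt_xs'; lia | lia | apply: new_xs; lia].
have [ph run_ph] : exists ph, forall s, (forall r, base.+4 <= r -> s r = 0) ->
    let x := map_tuple s [tuple of rcons (rcons xs i) v] in
    runs ph s (tauh (sumn x)) (upd s w (s w + h x)).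
  apply: comp_h; last 2 [lia].
  - by rewrite !all_rcons lt_xs'; lia.
  - by rewrite !(mem_rcons, inE) !negb_or new_xs; lia.
exists (PSeq (PSeq (PSeq (PSeq (pcopy yr c base.+4) pg)
  (PLoop c (PSeq (PSeq (PSeq ph (PClr v)) (pmove w v)) (PInc i))))
  (pmove v out)) (PClr i)) => s s0.
rewrite map_rcons_tuple; set X := map_tuple s xs.
set N := s yr; pose F k := f [tuple of rcons X k].
rewrite -/(F N) /= sumn_rcons; set S := sumn X + N.
have F0 : F 0 = g X by have [] := rec X.
have FS k : F k.+1 = h [tuple of rcons (rcons X k) (F k)].
  by have [_ /(_ k)[]] := rec X.
have le_F k : k <= N -> F k <= p S.
  move=> le_k; apply: leq_trans (le_p _) _; apply: poly_mono => //=.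
  by rewrite sumn_rcons leq_add2l.
pose sigma k := upd (upd (upd s c (N - k)) i k) v (F k).
have s0c : s c = 0 by apply: s0. have s0i : s i = 0 by apply: s0; lia.
have s0v : s v = 0 by apply: s0; lia. have s0w : s w = 0 by apply: s0; lia.
have init : runs (PSeq (pcopy yr c base.+4) pg) s (S * 5 + 2 + taug S) (sigma 0).
  apply: (@runs_seq _ _ _ _ (upd s c N)).
    apply: runs_le (_ : runs _ _ (N * 5 + 2) _) _; last by rewrite /S; lia.
    by apply: runs_copy; rewrite ?s0c //; try lia; apply: s0; lia.
  have X1 : map_tuple (upd s c N) xs = X.
    by apply: map_ins => r /(allP lt_xs) ?; rewrite /upd; case: eqP => //; lia.
  have -> : sigma 0 = upd (upd s c N) v (upd s c N v + g X).
    by rewrite -F0 /sigma; upd_eq.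
  have := run_pg (upd s c N); rewrite X1 => run_g.
  apply: runs_le (run_g _) _ => [r le_r|]; last first.
    by apply: poly_mono => //; apply: leq_addr.
  by rewrite /upd; case: eqP => ?; [lia | apply: s0; lia].
have loop : runs (PLoop c (PSeq (PSeq (PSeq ph (PClr v)) (pmove w v)) (PInc i)))
   (sigma 0) (N * (tauh (S + p S) + 3 * p S + 3).+1).+1 (sigma N).
  apply: runs_loop => [k _|k lt_k].
    by rewrite /sigma /upd; repeat (case: eqP => ?); lia.
  set s1 := upd (sigma k) c _.
  have X1 : map_tuple s1 [tuple of rcons (rcons xs i) v] =
      [tuple of rcons (rcons X k) (F k)].
    rewrite !map_rcons_tuple.
    have -> : map_tuple s1 xs = X.
      apply: map_ins => r /(allP lt_xs) ?; rewrite /s1 /sigma /upd.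
      by repeat (case: eqP => ?); lia.
    have -> : s1 i = k by rewrite /s1 /sigma /upd; repeat (case: eqP => ?); lia.
    by have -> : s1 v = F k by rewrite /s1 /sigma /upd; repeat (case: eqP => ?); lia.
  have s1_0 r : base.+4 <= r -> s1 r = 0.
    move=> le_r; rewrite /s1 /sigma /upd; repeat (case: eqP => ?); try lia.
    by apply: s0; lia.
  have := run_ph s1 s1_0; rewrite X1 /= !sumn_rcons -FS => run_h.
  have s1w : s1 w = 0 by rewrite /s1 /sigma /upd; repeat (case: eqP => ?); lia.
  have s1v : s1 v = F k by rewrite /s1 /sigma /upd; repeat (case: eqP => ?); lia.
  rewrite s1w add0n in run_h.
  have run_v := runs_clr (erefl (upd (upd s1 w (F k.+1)) v 0)).
  have wv : w != v by lia.
  have run_w := runs_move wv (erefl (upd (upd (upd (upd s1 w (F k.+1)) v 0) v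
     ((upd (upd s1 w (F k.+1)) v 0) v + (upd (upd s1 w (F k.+1)) v 0) w)) w 0)).
  have run_i : runs (PInc i) (upd (upd (upd (upd s1 w (F k.+1)) v 0) v
     ((upd (upd s1 w (F k.+1)) v 0) v + (upd (upd s1 w (F k.+1)) v 0) w)) w 0) 1
     (sigma k.+1).
    by apply: runs_inc; rewrite /s1 /sigma; upd_eq.
  apply: runs_le (runs_seq (runs_seq (runs_seq run_h run_v) run_w) run_i) _.
  have -> : upd s1 w (F k.+1) v = F k.
    by rewrite /upd; case: eqP => ?; [lia | exact: s1v].
  have -> : upd (upd s1 w (F k.+1)) v 0 w = F k.+1.
    by rewrite /upd; repeat (case: eqP => ?); lia.
  have : tauh (sumn X + k + F k) <= tauh (S + p S).
    by apply: poly_mono => //; apply: leq_add; [rewrite /S; lia | apply/le_F/ltnW].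
  rewrite -[sumn [seq _ | _ <- _]]/(sumn X).
  have := le_F k (ltnW lt_k); have := le_F k.+1 lt_k; lia.
have vo : v != out by lia.
have fin_move := runs_move vo (erefl (upd (upd (sigma N) out
   (sigma N out + sigma N v)) v 0)).
have fin_clr : runs (PClr i) (upd (upd (sigma N) out
   (sigma N out + sigma N v)) v 0) N.+1 (upd s out (s out + F N)).
  set s4 := upd _ v 0.
  have s4i : s4 i = N by rewrite /s4 /sigma /upd; repeat (case: eqP => ?); lia.
  have := @runs_clr i s4 (upd s out (s out + F N)); rewrite s4i; apply.
  by rewrite /s4 /sigma; upd_eq.
apply: runs_le (runs_seq (runs_seq (runs_seq init loop) fin_move) fin_clr) _.
have -> : sigma N v = F N by rewrite /sigma /upd eqxx.
have le_NS : N <= S by rewrite /S; lia.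
have := leq_mul le_NS (leqnn (tauh (S + p S) + 3 * p S + 4)).
by have := le_F N (leqnn N); lia.
Qed.

Lemma E2_computable n (f : nfun n) : E2 f -> computable f.
Proof.
elim=> {n f} [||n i|m n f g _ comp_f E2g comp_g
             |n g h j f _ comp_g _ comp_h E2j _ rec
             |n f g fg _ [tau poly_tau comp_f]].
- exact: computable_succ.
- exact: computable_f2.
- exact: computable_proj.
- by apply: computable_comp => // i; apply: E2_bound.
- have [p poly_p le_p] := E2_bound E2j.
  apply: (computable_rec comp_g comp_h rec poly_p) => x.
  have [u [a ->]] := tuple_rconsP x; apply: leq_trans (le_p _).
  by have [_ /(_ a)[]] := rec u.
- exists tau => // ins out base lt_ins lt_out out_ins.
  have [p run_p] := comp_f ins out base lt_ins lt_out out_ins.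
  by exists p => s s0; rewrite -fg; apply: run_p.
Qed.

(** * Definability by arithmetic superpositions *)

Lemma nth_tuple_funs n m (f0 : nfun n) (fs : seq (nfun n)) x k : k < m ->
  nth 0 [tuple nth f0 fs i x | i < m] k = nth f0 fs k x.
Proof.
by move=> lt_km; rewrite (nth_mktuple (fun i : 'I_m => nth f0 fs i x) 0 (Ordinal lt_km)).
Qed.

Section Substitution.

Variable C : fclass.
Hypothesis C_comp : forall m n (f : nfun m) (g : 'I_m -> nfun n), C f ->
  (forall i, C (g i)) -> C (fun x : n.-tuple nat => f [tuple g i x | i < m]).
Hypothesis C_ext : forall n (f g : nfun n), f =1 g -> C f -> C g.

Variable n : nat.
Implicit Types f : nfun n.

Lemma subst1 F f1 : C (fun1 F) -> C f1 -> C (fun x : n.-tuple nat => F (f1 x)).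
Proof.
move=> CF C1; apply: C_ext (C_comp (g := fun=> f1) CF (fun=> C1)) => x.
by rewrite /fun1 (nth_mktuple _ 0 ord0).
Qed.

Lemma subst2 F f1 f2 : C (fun2 F) -> C f1 -> C f2 ->
  C (fun x : n.-tuple nat => F (f1 x) (f2 x)).
Proof.
move=> CF C1 C2.
have C12 (i : 'I_2) : C (nth f1 [:: f1; f2] i) by case: i => -[|[]].
by apply: C_ext (C_comp CF C12) => x; rewrite /fun2 !nth_tuple_funs.
Qed.

End Substitution.

Notation arith := (superposition_closure arith_base).

Section Arithmetic.

Variable n : nat.
Implicit Types f g : nfun n.+1.

Lemma arith1 F f : arith_base (fun1 F) -> arith f -> arith (fun x => F (f x)).
Proof.
move=> /sup_base; exact: (subst1 (@sup_comp _) (@sup_ext _)).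
Qed.

Lemma arith2 F f g : arith_base (fun2 F) -> arith f -> arith g ->
  arith (fun x => F (f x) (g x)).
Proof.
move=> /sup_base; exact: (subst2 (@sup_comp _) (@sup_ext _)).
Qed.

(** Zero is obtained as [x - x], which takes a variable; hence the arity [n.+1]. *)
Lemma arith_const c : arith (fun _ : n.+1.-tuple nat => c).
Proof.
elim: c => [|c IH]; last exact: (arith1 base_succ).
have Px := sup_proj arith_base (@ord0 n).
by apply: sup_ext (arith2 base_sub Px Px) => x; apply: subnn.
Qed.

Lemma arith_mul f g : arith f -> arith g -> arith (fun x => f x * g x).
Proof. exact: (arith2 base_mul). Qed.

Lemma arith_sub f g : arith f -> arith g -> arith (fun x => f x - g x).
Proof. exact: (arith2 base_sub). Qed.

Lemma arith_div f g : arith f -> arith g -> arith (fun x => f x %/ g x).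
Proof. exact: (arith2 base_div). Qed.

(** By [(a + 1) * (b + 1) - a * b - 1 = a + b]. *)
Lemma arith_add f g : arith f -> arith g -> arith (fun x => f x + g x).
Proof.
move=> Af Ag.
have ASS := arith_mul (arith1 base_succ Af) (arith1 base_succ Ag).
apply: sup_ext (arith_sub (arith_sub ASS (arith_mul Af Ag)) (arith_const 1)).
by move=> x /=; lia.
Qed.

Lemma arith_mod f g : arith f -> arith g -> arith (fun x => f x %% g x).
Proof.
move=> Af Ag; apply: sup_ext (arith_sub Af (arith_mul (arith_div Af Ag) Ag)).
by move=> x; rewrite {1}(divn_eq (f x) (g x)) addKn.
Qed.

Lemma arith_sum m (F : 'I_m -> nfun n.+1) : (forall i, arith (F i)) ->
  arith (fun x => \sum_(i < m) F i x).
Proof.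
elim: m F => [|m IH] F AF.
  by apply: sup_ext (arith_const 0) => x; rewrite big_ord0.
have := arith_add (AF ord0) (IH (fun i => F (lift ord0 i)) (fun=> AF _)).
by apply: sup_ext => x; rewrite big_ord_recl.
Qed.

Lemma arith_exp f k : arith f -> arith (fun x => f x ^ k).
Proof.
move=> Af; elim: k => [|k IH]; first exact: arith_const.
by apply: sup_ext (arith_mul Af IH) => x; rewrite expnS.
Qed.

Lemma arith_poly p f : poly p -> arith f -> arith (fun x => p (f x)).
Proof.
move=> + Af; elim=> [c||p1 p2 _ A1 _ A2|p1 p2 _ A1 _ A2] //.
- exact: arith_const.
- exact: arith_add.
- exact: arith_mul.
Qed.

Lemma arith_sumn : arith (fun x : n.+1.-tuple nat => sumn x).
Proof.
have := arith_sum (fun i => sup_proj arith_base i).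
by apply: sup_ext => x; rewrite sumnE big_tuple.
Qed.

Lemma arith_nth k : arith (fun x : n.+1.-tuple nat => nth 0 x k).
Proof.
have [lt_kn|le_nk] := ltnP k n.+1; last first.
  by apply: sup_ext (arith_const 0) => x; rewrite nth_default ?size_tuple.
apply: sup_ext (sup_proj _ (Ordinal lt_kn)) => x.
by rewrite (tnth_nth 0).
Qed.

(** The number [K] of fields is fixed and only their width varies with the arguments, so the sum has
    constant length. *)
Lemma arith_tape K (W : nfun n.+1) (X : n.+1.-tuple nat -> nat -> nat) :
    (forall x, 0 < W x) -> arith (fun x => 2 ^ W x) ->
    (forall i, arith (fun x => X x i)) ->
  arith (fun x => tape (W x) K (X x)).
Proof.
move=> W0 AW AX; apply: arith_sum => i.
apply: arith_mul; last exact: arith_exp.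
apply: arith_add => //; apply: arith_mul; first exact: arith_const.
apply: sup_ext (arith_div AW (arith_const 2)) => x.
by case: (W x) (W0 x) => // w _; rewrite expnSr mulnK.
Qed.

Section Rules.

Variables (nr : nat) (L : seq instr) (l : nfun n.+1).
Hypothesis Ab : arith (fun x => 2 ^ l x).

Lemma arith_mask e : arith (fun x => test_mask nr L (l x) e).
Proof.
apply: arith_sum => k; apply: arith_mul; last exact: arith_exp.
apply: arith_mul; first exact: arith_const.
by apply: sup_ext (arith_sub Ab (arith_const 1)) => x; rewrite subn1.
Qed.

Lemma arith_addend e : arith (fun x => addend nr L (l x) e).
Proof.
rewrite /addend; case: (fetch L e./2) => [r d|r z d]; case: (odd e).
- exact: arith_const.
- by apply: arith_sub; do ?apply: arith_add; apply: arith_exp.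
- by do ?apply: arith_sub; do ?apply: arith_add; apply: arith_exp.
- by apply: arith_sub; do ?apply: arith_add; apply: arith_exp.
Qed.

Lemma arith_enc a :
  arith (fun x : n.+1.-tuple nat => enc nr L (l x) (a, nth 0 (0 :: x))).
Proof.
apply: arith_sum => k; apply: arith_mul; last exact: arith_exp.
rewrite /reg /=; case: (k < nr); last exact: arith_const.
case: (nat_of_ord k) => [|j]; [exact: arith_const | exact: arith_nth].
Qed.

End Rules.

End Arithmetic.

Lemma arith_behead n (f : nfun n.+1) : arith f ->
  arith (fun x : n.+2.-tuple nat => f [tuple of behead x]).
Proof.
move=> Af; have := sup_comp Af (fun i => sup_proj arith_base (lift (@ord0 n.+1) i)).
apply: sup_ext => x; congr f; apply: eq_from_tnth => i.
rewrite tnth_mktuple tnth_behead; congr (tnth x _); apply: val_inj.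
by rewrite [RHS]inordK; [exact: lift0 | exact: (ltn_ord i)].
Qed.

Lemma E2_arity n (f : nfun n) : E2 f -> 0 < n.
Proof.
elim=> {n f} // [n [i lt_in]|m n f g _ m0 _ IH].
  exact: leq_ltn_trans (leq0n i) lt_in.
by case: m m0 g IH {f} => // m _ g /(_ ord0).
Qed.

(** * Simulation of a fixed program by [Q] *)

Section Simulation.

Variables (nr : nat) (L : seq instr) (l : nat).
Let b := 2 ^ l.
Let w := width nr L.
Let K := (size L).*2.

(** Beyond the [w] digits of an encoding, one digit receives the accumulated multiples of [b ^ w],
    and another leaves room for the marker. *)
Definition mask_width := l * w.+2.
(** The surplus [l] over the whole mask tape makes [2 ^ addend_width] equal to
    [(2 ^ mask_width) ^ K * b], which is a superposition. *)
Definition addend_width := mask_width * K + l.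

Hypothesis l_gt0 : 0 < l.
Hypothesis L_gt0 : 0 < size L.
Hypothesis nr_gt0 : 0 < nr.
Hypothesis wf : forall i, i < size L -> wf_instr nr L i (fetch L i).

Let b_gt1 : 1 < b.
Proof. by rewrite -(expn0 2) ltn_exp2l. Qed.

Lemma addend_le e : e < K -> addend nr L l e <= 3 * b ^ w.
Proof.
move=> lt_e; have lt_i : e./2 < size L by rewrite /K in lt_e; lia.
have pow_le k : k <= w -> b ^ k <= b ^ w by move=> le_k; rewrite leq_exp2l.
have pc_le : b ^ (nr + e./2) <= b ^ w by apply: pow_le; rewrite /w /width; lia.
have := wf lt_i; rewrite /addend -/b -/w.
case: (fetch L e./2) => [r d|r z d]; case: (odd e) => //=; try lia.
case/andP => lt_r _; have : b ^ r <= b ^ w by apply: pow_le; rewrite /w /width; lia.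
lia.
Qed.

Lemma Q_scan s T : (forall u k, k < nr -> (scan L (0, s) u).2 k < b) ->
    6 * (T * size L) + 3 < b ->
  Q (enc nr L l (0, s))
    (tape mask_width K (test_mask nr L l)) (tape addend_width K (addend nr L l))
    mask_width addend_width (T * size L).*2 %% b =
  (scan L (0, s) (T * size L)).2 0.
Proof.
move=> data lt_b.
have K0 : 0 < K by rewrite double_gt0.
have W10 : 0 < mask_width by rewrite muln_gt0 l_gt0.
have pow_mask : b ^ w.+1 <= 2 ^ mask_width.-1.
  by rewrite -expnM leq_exp2l // /mask_width mulnS; lia.
have W12 : mask_width * K < addend_width by rewrite /addend_width; lia.
have pow_addend : 2 ^ mask_width.-1 <= 2 ^ addend_width.-1.
  by rewrite leq_exp2l //; nia.
have reg_lt k : k < w -> reg nr (0, s) k < b.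
  move=> _; rewrite /reg; case: ifP => [/(data 0) //|_].
  by case: (_ != _); rewrite // ltnW.
have enc_lt : enc nr L l (0, s) < b ^ w by apply: digits_lt.
have bw0 : 0 < b ^ w by rewrite expn_gt0 ltnW.
have mask_lt e : e < K -> test_mask nr L l e < 2 ^ mask_width.-1.
  move=> _; apply: leq_trans pow_mask.
  have : test_mask nr L l e < b ^ w.
    apply: (@digits_lt _ (fun k => guard nr L e k * b.-1)) => k _.
    by case: (guard _ _ _ _); lia.
  by rewrite expnS; nia.
have addend_lt e : e < K -> addend nr L l e < 2 ^ addend_width.-1.
  move=> lt_e; apply: leq_trans pow_addend; apply: leq_trans pow_mask.
  have := addend_le lt_e; rewrite expnS; nia.
set x0 := enc _ _ _ _ in enc_lt *.
(* Each of the [2 * T * size L] rules adds at most [3 * b ^ w] to a start below [b ^ w]; the assumed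
   lower bound on [b] keeps the total below [b ^ w.+1]. *)
have run_lt t : t <= (T * size L).*2 ->
    masked_run (fun t => test_mask nr L l (t %% K)) (fun t => addend nr L l (t %% K))
      x0 t < 2 ^ mask_width.-1.
  move=> le_t; apply: leq_trans pow_mask.
  have addend_mod e : addend nr L l (e %% K) <= 3 * b ^ w.
    by apply: addend_le; rewrite ltn_mod.
  have := masked_run_le (fun t => test_mask nr L l (t %% K)) x0 t addend_mod.
  move=> /leq_ltn_trans; apply; rewrite expnS; nia.
have := Q_masked_run W10 K0 W12 mask_lt addend_lt run_lt.
have [m ->] := scan_rules l_gt0 (T * size L) L_gt0 wf data.
(* Register 0 is the lowest digit, so the result may be reduced modulo [b], a divisor of the modulus
   of the run. *)
have b_dvd : b %| 2 ^ addend_width.-1.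
  by rewrite dvdn_exp2l // /addend_width; nia.
rewrite -(modn_dvdm _ b_dvd) => ->.
rewrite /enc -/w /w /width addnS digits_recl -/b.
rewrite expnS -mulnA [b * (_ * m)]mulnC -addnA -mulnDl addnC modnMDl.
by rewrite /reg nr_gt0 modn_small // data.
Qed.

End Simulation.

Lemma E2_via_Q n (f : nfun n) : E2 f ->
  exists (h : nfun n.+1) (g : 'I_6 -> nfun n),
    [/\ arith h, forall i, arith (g i) &
        forall y : n.-tuple nat,
          f y = h [tuple of fun6 Q [tuple g i y | i < 6] :: y]].
Proof.
move=> E2f; case: n f E2f (E2_arity E2f) => // n f E2f _.
have [tau poly_tau comp_f] := E2_computable E2f.
(* Argument [i] sits in register [i + 1]; register 0, initially zero, is the output. *)
pose ins : n.+1.-tuple nat := [tuple (i : nat).+1 | i < n.+1].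
have lt_ins : all (fun r => r < n.+2) ins.
  by apply/allP => r /tnthP[i ->]; rewrite tnth_mktuple; apply: (ltn_ord i).
have out_ins : 0 \notin ins by apply/negP => /tnthP[i]; rewrite tnth_mktuple.
have [p run_p] := comp_f ins 0 n.+2 lt_ins isT out_ins.
pose L := compile p 0 (psize p); pose nr := (pregs p).+1.
have sizeL : size L = psize p by apply: size_compile.
have L0 : 0 < size L by rewrite sizeL psize_gt0.
have wf i : i < size L -> wf_instr nr L i (fetch L i).
  rewrite sizeL => lt_i.
  by apply: (@compile_wf L nr p 0 (psize p)) => //; rewrite ?sizeL ?leqnn.
pose T (y : n.+1.-tuple nat) := tau (sumn y).
(* [sumn y + T y] bounds the registers; the remaining terms meet the lower bound on [b] in
   [Q_scan]. *)
pose N (y : n.+1.-tuple nat) := sumn y + T y + 6 * (T y * size L) + 3.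
pose l (y : n.+1.-tuple nat) := (trunc_log 2 (N y)).+1.
have lt_N y : N y < 2 ^ l y by apply: trunc_log_ltn.
pose s (y : n.+1.-tuple nat) := nth 0 (0 :: y).
have A_T : arith T by apply: arith_poly => //; apply: arith_sumn.
have A_N : arith N.
  do ![apply: arith_add | apply: arith_mul | apply: arith_const] => //.
  exact: arith_sumn.
have A_log : arith (fun y => trunc_log 2 (N y)) by apply: (arith1 base_log).
(* Powers of 2 are available only in the form [minn x (2 ^ y)]. Since [N] is positive,
   [2 ^ trunc_log 2 N] is at most [N] and the minimum is this power. *)
have A_b : arith (fun y => 2 ^ l y).
  apply: sup_ext (arith_mul (arith_const n 2) (arith2 base_min_exp A_N A_log)).
  move=> y /=; rewrite /l expnS (minn_idPr _) //; apply: trunc_logP => //.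
  by rewrite /N addn3.
have A_l : arith l by apply: (arith1 base_succ).
pose K := (size L).*2.
pose W1 (y : n.+1.-tuple nat) := mask_width nr L (l y).
pose W2 (y : n.+1.-tuple nat) := addend_width nr L (l y).
have A_W1 : arith W1 by apply: arith_mul => //; apply: arith_const.
have A_W2 : arith W2.
  by apply: arith_add => //; apply: arith_mul => //; apply: arith_const.
have A_2W1 : arith (fun y => 2 ^ W1 y).
  by apply: sup_ext (arith_exp (width nr L).+2 A_b) => y; rewrite -expnM.
have A_2W2 : arith (fun y => 2 ^ W2 y).
  apply: sup_ext (arith_mul (arith_exp K A_2W1) A_b) => y.
  by rewrite -expnM -expnD.
have W1_gt0 y : 0 < W1 y by rewrite muln_gt0.
have W2_gt0 y : 0 < W2 y by rewrite addn_gt0 orbT.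
pose gs : seq (nfun n.+1) :=
  [:: fun y => enc nr L (l y) (0, s y);
      fun y => tape (W1 y) K (test_mask nr L (l y));
      fun y => tape (W2 y) K (addend nr L (l y));
      W1; W2; fun y => (T y * size L).*2].
pose h (z : n.+2.-tuple nat) := tnth z ord0 %% 2 ^ l [tuple of behead z].
exists h, (fun i => nth W1 gs i); split.
- by apply: arith_mod; [apply: sup_proj | apply: (arith_behead A_b)].
- case=> -[|[|[|[|[|[|//]]]]]] _ //=.
  + exact: arith_enc.
  + by apply: arith_tape => // i; apply: arith_mask.
  + by apply: arith_tape => // i; apply: arith_addend.
  + apply: sup_ext (arith_mul (arith_const n 2) (arith_mul A_T (arith_const n (size L)))).
    by move=> y; rewrite mul2n.
- move=> y; rewrite /h tnth0; set q := fun6 _ _.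
  have -> : [tuple of behead [tuple of q :: y]] = y by apply: val_inj.
  rewrite /q /fun6 !nth_tuple_funs //=.
  have map_s : map_tuple (s y) ins = y.
    apply: eq_from_tnth => i; rewrite tnth_map tnth_mktuple /s /=.
    by rewrite -(tnth_nth 0).
  have s0 r : n.+2 <= r -> s y r = 0.
    by move=> le_r; rewrite /s nth_default //= size_tuple.
  have := run_p (s y) s0; rewrite map_s; case=> t le_t run_t.
  have [growth final] := scan_compile run_t.
  rewrite (@Q_scan nr L (l y)) //; last 2 first.
  + move=> u k _; apply: leq_ltn_trans (growth u k) _.
    have le_s : s y k <= sumn y.
      case: k => [//|k]; rewrite /s /=.
      have [lt_k|le_k] := ltnP k n.+1; last by rewrite nth_default ?size_tuple.
      by rewrite -(tnth_nth 0 y (Ordinal lt_k)) leq_sumn_tnth.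
    by apply: leq_ltn_trans (lt_N y); rewrite /N /T; lia.
  + by apply: leq_ltn_trans (lt_N y); rewrite /N /T; lia.
  by rewrite final.
Qed.

(** * [Q] belongs to E^2 *)

Lemma E2_nth n k : k < n -> E2 (fun x : n.-tuple nat => nth 0 x k).
Proof.
move=> lt_kn; apply: E2_ext (E2_proj (Ordinal lt_kn)) => x.
by rewrite (tnth_nth 0).
Qed.

Lemma E2_fun1 n F (f : nfun n) : E2 (fun1 F) -> E2 f -> E2 (fun x => F (f x)).
Proof. exact: (subst1 E2_comp E2_ext). Qed.

Lemma E2_fun2 n F (f g : nfun n) : E2 (fun2 F) -> E2 f -> E2 g ->
  E2 (fun x => F (f x) (g x)).
Proof. exact: (subst2 E2_comp E2_ext). Qed.

(** No constant is available yet, so the recursion starts from its parameter; identified with the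
    recursion variable, this gives 0 at 0. *)
Lemma E2_pred n (f : nfun n) : E2 f -> E2 (fun x => (f x).-1).
Proof.
move=> Ef; pose F x y := if y is y'.+1 then y' else x.
have EF : E2 (fun2 F).
  apply: (@E2_rec 1 (fun x => nth 0 x 0) (fun z => nth 0 z 1)
    (fun2 (fun x y => x.+1 * y.+1))) => //; try exact: E2_nth.
    exact: E2_f2.
  case=> -[|a []] // sz; split=> // y; split=> //.
  by rewrite /fun2 /=; case: y => [|y]; rewrite /F; lia.
apply: E2_ext (E2_fun2 EF Ef Ef) => x.
by rewrite /F; case: (f x).
Qed.

Lemma E2_sub n (f g : nfun n) : E2 f -> E2 g -> E2 (fun x => f x - g x).
Proof.
apply: E2_fun2; apply: (@E2_rec 1 (fun x => nth 0 x 0)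
  (fun z => (nth 0 z 2).-1) (fun z => nth 0 z 0)); try exact: E2_nth.
  by apply: E2_pred; apply: E2_nth.
case=> -[|a []] // sz; rewrite /fun2 /=; split=> [|y]; first exact: subn0.
by rewrite subnS leq_subr.
Qed.

Lemma E2_S n (f : nfun n) : E2 f -> E2 (fun x => (f x).+1).
Proof. exact: (E2_fun1 E2_succ). Qed.

(** By [(a + 1) * (b + 1) - (a + 1) - b = a * b]. *)
Lemma E2_mul n (f g : nfun n) : E2 f -> E2 g -> E2 (fun x => f x * g x).
Proof.
move=> Ef Eg.
apply: E2_ext (E2_sub (E2_sub (E2_fun2 E2_f2 Ef Eg) (E2_S Ef)) Eg) => x.
by rewrite mulSn mulnS; lia.
Qed.

Lemma E2_add n (f g : nfun n) : E2 f -> E2 g -> E2 (fun x => f x + g x).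
Proof.
move=> Ef Eg.
apply: E2_ext (E2_pred (E2_sub (E2_fun2 E2_f2 Ef Eg) (E2_mul Ef Eg))) => x.
by rewrite mulSn mulnS; lia.
Qed.

Lemma E2_const n c : E2 (fun _ : n.+1.-tuple nat => c).
Proof.
elim: c => [|c IH]; last exact: E2_S.
have Px := E2_proj (@ord0 n).
by apply: E2_ext (E2_sub Px Px) => x; apply: subnn.
Qed.

Lemma E2_poly n p (f : nfun n.+1) : poly p -> E2 f -> E2 (fun x => p (f x)).
Proof.
move=> + Ef; elim=> [c||p1 p2 _ E1 _ E2'|p1 p2 _ E1 _ E2'] //.
- exact: E2_const.
- exact: E2_add.
- exact: E2_mul.
Qed.

Lemma E2_sumn n : E2 (fun x : n.+1.-tuple nat => sumn x).
Proof.
suff claim k (le_kn : k <= n.+1) :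
    E2 (fun x : n.+1.-tuple nat => \sum_(i < k) nth 0 x i).
  apply: E2_ext (claim _ (leqnn _)) => x; rewrite sumnE big_tuple.
  by apply: eq_bigr => i _; rewrite (tnth_nth 0).
elim: k le_kn => [|k IH] le_kn.
  by apply: E2_ext (E2_const n 0) => x; rewrite big_ord0.
have := E2_add (IH (ltnW le_kn)) (E2_nth le_kn).
by apply: E2_ext => x; rewrite big_ord_recr.
Qed.

Lemma E2_init n (f : nfun n) : E2 f ->
  exists2 f' : nfun n.+1, E2 f' &
    forall (x : n.-tuple nat) a, f' [tuple of rcons x a] = f x.
Proof.
move=> Ef; have lt_i (i : 'I_n) : i < n.+1 by apply: leq_trans (ltn_ord i) _.
exists (fun z => f [tuple nth 0 z i | i < n]).
  by apply: (E2_comp (g := fun i z => nth 0 z i)) => // i; apply: E2_nth.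
move=> x a; congr f; apply: eq_from_tnth => i.
by rewrite tnth_mktuple nth_rcons size_tuple ltn_ord -tnth_nth.
Qed.

Lemma E2_last n : E2 (fun z : n.+1.-tuple nat => nth 0 z n).
Proof. exact: E2_nth. Qed.

Lemma nth_rcons_last n (x : n.-tuple nat) a : nth 0 (rcons x a) n = a.
Proof. by rewrite nth_rcons size_tuple ltnn eqxx. Qed.

(** A sum of [y] polynomially bounded terms is polynomially bounded, which supplies the majorant of
    the recursion. *)
Lemma E2_sum n (f F : nfun n.+2) : E2 f ->
    (forall (x : n.+1.-tuple nat) y, F [tuple of rcons x y] =
       \sum_(i < y) f [tuple of rcons x i]) ->
  E2 F.
Proof.
move=> Ef eF; have [f' Ef' f'E] := E2_init Ef.
have [p poly_p le_p] := E2_bound Ef.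
apply: (@E2_rec n.+1 (fun=> 0) (fun z => nth 0 z n.+2 + f' z)
  (fun z => sumn z * p (sumn z))).
- exact: E2_const.
- by apply: E2_add => //; apply: E2_last.
- apply: E2_mul; first exact: E2_sumn.
  by apply: E2_poly => //; apply: E2_sumn.
move=> x; split=> [|y]; first by rewrite eF big_ord0.
split; first by rewrite nth_rcons_last f'E !eF big_ord_recr.
rewrite eF /= sumn_rcons; apply: leq_trans (_ : y * p (sumn x + y) <= _).
  have -> : y * p (sumn x + y) = \sum_(i < y) p (sumn x + y).
    by rewrite sum_nat_const card_ord.
  apply: leq_sum => i _.
  apply: leq_trans (le_p _) _; apply: poly_mono => //=.
  by rewrite sumn_rcons leq_add2l ltnW.
by rewrite leq_mul2r leq_addl orbT.
Qed.

(** * Binary digits and division in E^2 *)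

Lemma E2_odd n (f : nfun n.+1) : E2 f -> E2 (fun x => odd (f x) : nat).
Proof.
move=> Ef; apply: (E2_fun2 (F := fun _ y => odd y : nat) _ Ef Ef).
apply: (@E2_rec 1 (fun=> 0) (fun z => 1 - nth 0 z 2) (fun=> 1)).
- exact: E2_const.
- by apply: E2_sub; [apply: E2_const | apply: E2_nth].
- exact: E2_const.
case=> -[|a []] // sz; rewrite /fun2 /=; split=> // y.
by case: (odd y).
Qed.

(** [y./2] counts the odd numbers below [y]. *)
Lemma E2_half n (f : nfun n.+1) : E2 f -> E2 (fun x => (f x)./2).
Proof.
move=> Ef; apply: (E2_fun2 (F := fun _ y => y./2) _ Ef Ef).
apply: (E2_sum (f := fun z => odd (nth 0 z 1) : nat)).
  by apply: E2_odd; apply: E2_nth.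
case=> -[|a []] // sz y; rewrite /fun2 /=.
elim: y => [|y IH]; first by rewrite big_ord0.
by rewrite big_ord_recr /= -IH; lia.
Qed.

(** Halving is iterated, since [2 ^ y] itself outgrows E^2. *)
Lemma E2_shiftr n (f g : nfun n.+1) : E2 f -> E2 g -> E2 (fun x => f x %/ 2 ^ g x).
Proof.
apply: (E2_fun2 (F := fun x y => x %/ 2 ^ y)).
apply: (@E2_rec 1 (fun x => nth 0 x 0) (fun z => (nth 0 z 2)./2)
  (fun z => nth 0 z 0)); try exact: E2_nth.
  by apply: E2_half; apply: E2_nth.
case=> -[|a []] // sz; rewrite /fun2 /=; split=> [|y]; first exact: divn1.
by rewrite expnSr divnMA divn2 leq_div.
Qed.

Lemma E2_testbit n (f g : nfun n.+1) : E2 f -> E2 g ->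
  E2 (fun x => Nat.testbit (f x) (g x) : nat).
Proof.
move=> Ef Eg; apply: E2_ext (E2_odd (E2_shiftr Ef Eg)) => x.
by rewrite testbitE.
Qed.

Lemma sum_ltn_ord y k : \sum_(i < y) (i < k : nat) = minn y k.
Proof.
by elim: y => [|y IH]; rewrite ?big_ord0 ?min0n // big_ord_recr /= IH; lia.
Qed.

(** The logarithm counts the [i] with [2 ^ i.+1 <= x]; here [1 - (1 - a)] is the sign of [a]. *)
Lemma E2_log n (f : nfun n.+1) : E2 f -> E2 (fun x => trunc_log 2 (f x)).
Proof.
move=> Ef; pose F x y := \sum_(i < y) (1 - (1 - x %/ 2 ^ i.+1)).
have EF : E2 (fun2 F).
  apply: (E2_sum (f := fun z => 1 - (1 - nth 0 z 0 %/ 2 ^ (nth 0 z 1).+1))).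
    do 2?[apply: E2_sub; first exact: E2_const].
    by apply: E2_shiftr; [| apply: E2_S]; apply: E2_nth.
  by case=> -[|a []].
apply: E2_ext (E2_fun2 EF Ef Ef) => x; rewrite /F; move: (f x) => {f Ef x} x.
have -> : \sum_(i < x) (1 - (1 - x %/ 2 ^ i.+1)) =
    \sum_(i < x) (i < trunc_log 2 x : nat).
  apply: eq_bigr => i _; have x0 : 0 < x by apply: leq_ltn_trans (ltn_ord i).
  have -> : (i < trunc_log 2 x) = (0 < x %/ 2 ^ i.+1).
    rewrite divn_gt0 ?expn_gt0 //; apply/idP/idP => [lt_i|]; last exact: trunc_log_max.
    by apply: leq_trans _ (trunc_logP (isT : 1 < 2) x0); rewrite leq_exp2l.
  by case: (_ %/ _).
rewrite sum_ltn_ord; apply/minn_idPr.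
case: x => // x; apply: leq_trans (ltnW (ltn_expl _ (isT : 1 < 2))) _.
exact: trunc_logP.
Qed.

(** The quotient counts the [i] with [i.+1 * d <= x]. For [d = 0] the product subtracted is 0, in
    accordance with [x %% 0 = x]. *)
Lemma E2_mod n (f g : nfun n.+1) : E2 f -> E2 g -> E2 (fun x => f x %% g x).
Proof.
move=> Ef Eg; apply: E2_fun2 Ef Eg.
pose F x d y := \sum_(i < y) (1 - (i.+1 * d - x)).
have EF : E2 (fun z : 3.-tuple nat => F (nth 0 z 0) (nth 0 z 1) (nth 0 z 2)).
  apply: (E2_sum (f := fun z => 1 - ((nth 0 z 2).+1 * nth 0 z 1 - nth 0 z 0))).
    apply: E2_sub; first exact: E2_const.
    by apply: E2_sub; [apply: E2_mul; [apply: E2_S|] |]; apply: E2_nth.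
  by case=> -[|a [|c []]].
have EFx : E2 (fun2 (fun x d => F x d x)).
  have E01 (i : 'I_3) : E2 (fun z : 2.-tuple nat => nth 0 z (i %% 2)).
    by apply: E2_nth; rewrite ltn_mod.
  apply: E2_ext (E2_comp EF E01) => z; rewrite /fun2.
  have nthE k (lt_k : k < 3) :
      nth 0 [tuple nth 0 z (i %% 2) | i < 3] k = nth 0 z (k %% 2).
    exact: (nth_mktuple (fun i : 'I_3 => nth 0 z (i %% 2)) 0 (Ordinal lt_k)).
  by rewrite !nthE.
have E0 := @E2_nth 2 0 isT; have E1 := @E2_nth 2 1 isT.
apply: E2_ext (E2_sub E0 (E2_mul (E2_fun2 EFx E0 E1) E1)) => z; rewrite /fun2.
move: (nth 0 z 0) (nth 0 z 1) => x d; rewrite {1}(divn_eq x d).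
suff -> : F x d x * d = x %/ d * d by rewrite addKn.
case: d => [|d]; first by rewrite !muln0.
congr (_ * _); rewrite /F.
have -> : \sum_(i < x) (1 - (i.+1 * d.+1 - x)) = \sum_(i < x) (i < x %/ d.+1 : nat).
  by apply: eq_bigr => i _; rewrite leq_divRL //; lia.
by rewrite sum_ltn_ord; apply/minn_idPr/leq_div.
Qed.

(** By [min(x, 2 ^ y.+1) = min(x, 2 * min(x, 2 ^ y))], a recursion bounded by [x]. *)
Lemma E2_min_exp n (f g : nfun n.+1) : E2 f -> E2 g ->
  E2 (fun x => minn (f x) (2 ^ g x)).
Proof.
apply: (E2_fun2 (F := fun x y => minn x (2 ^ y))).
have minE a c : c - (c - a) = minn a c by lia.
apply: (@E2_rec 1 (fun x => 1 - (1 - nth 0 x 0))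
  (fun z => 2 * nth 0 z 2 - (2 * nth 0 z 2 - nth 0 z 0)) (fun z => nth 0 z 0)).
- by do 2![apply: E2_sub; first exact: E2_const]; apply: E2_nth.
- have E22 : E2 (fun z : 3.-tuple nat => 2 * nth 0 z 2).
    by apply: E2_mul; [apply: E2_const | apply: E2_nth].
  by do 2![apply: E2_sub => //]; apply: E2_nth.
- exact: E2_nth.
case=> -[|a []] // sz; rewrite /fun2 /=; split=> [|y]; first by rewrite minE.
by rewrite minE expnS; split; lia.
Qed.

(** Up to the leading digit the powers do not exceed [x], so the truncated ones, which lie in E^2,
    can replace them. The formula also absorbs the case [x < 2]. *)
Lemma RE x y : R x y = \sum_(i < (trunc_log 2 x).+1)
  Nat.testbit x ((i + y) %% (trunc_log 2 x).+1) * minn x (2 ^ i).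
Proof.
rewrite /R; case: ltnP => [|x2].
  by case: x => [|[|//]] _; rewrite ?trunc_log0 ?trunc_log1 big_ord1 modn1.
apply: eq_bigr => i _; congr (_ * _); apply/esym/minn_idPr.
apply: leq_trans _ (trunc_logP (isT : 1 < 2) (ltnW x2)).
by rewrite leq_exp2l // -ltnS.
Qed.

Lemma E2_R n (f g : nfun n.+1) : E2 f -> E2 g -> E2 (fun x => R (f x) (g x)).
Proof.
apply: E2_fun2.
pose F x y k := \sum_(i < k)
  Nat.testbit x ((i + y) %% (trunc_log 2 x).+1) * minn x (2 ^ i).
have EF : E2 (fun z : 3.-tuple nat => F (nth 0 z 0) (nth 0 z 1) (nth 0 z 2)).
  pose x (z : 3.-tuple nat) := nth 0 z 0; have Ex : E2 x by apply: E2_nth.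
  apply: (E2_sum (f := fun z =>
    Nat.testbit (x z) ((nth 0 z 2 + nth 0 z 1) %% (trunc_log 2 (x z)).+1)
    * minn (x z) (2 ^ nth 0 z 2))).
    apply: E2_mul; last by apply: E2_min_exp => //; apply: E2_nth.
    apply: E2_testbit => //; apply: E2_mod; last exact/E2_S/E2_log.
    by apply: E2_add; apply: E2_nth.
  by case=> -[|a [|c []]].
pose fs : seq (nfun 2) :=
  [:: fun z : 2.-tuple nat => nth 0 z 0; fun z : 2.-tuple nat => nth 0 z 1;
      fun z : 2.-tuple nat => (trunc_log 2 (nth 0 z 0)).+1].
have Efs (i : 'I_3) : E2 (nth (fun=> 0) fs i).
  case: i => -[|[|[|//]]] _ /=; try exact: E2_nth.
  by apply/E2_S/E2_log/E2_nth.
apply: E2_ext (E2_comp EF Efs) => z.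
by rewrite !nth_tuple_funs // /fun2 RE.
Qed.

(** Only the vanishing of the conjunction matters, so counting common bits suffices; all bits of [a]
    lie below position [a]. *)
Definition common_bits a b :=
  \sum_(i < a) Nat.testbit a i * Nat.testbit b i.

Lemma common_bits_eq0 a b : (common_bits a b == 0) = (Nat.land a b == 0).
Proof.
rewrite /common_bits sum_nat_eq0; apply/forallP/land_eq0P => disj i.
  have [lt_ia|le_ai] := ltnP i a.
    have := disj (Ordinal lt_ia); rewrite /= !testbitE muln_eq0.
    by case: (odd _); case: (odd _).
  rewrite divn_small //; apply: leq_ltn_trans le_ai _; exact: ltn_expl.
by rewrite /= !testbitE; have := disj i; case: (odd _); case: (odd _).
Qed.

Lemma E2_common_bits n (f g : nfun n.+1) : E2 f -> E2 g ->
  E2 (fun x => common_bits (f x) (g x)).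
Proof.
apply: E2_fun2.
pose F a b k := \sum_(i < k) Nat.testbit a i * Nat.testbit b i.
have EF : E2 (fun z : 3.-tuple nat => F (nth 0 z 0) (nth 0 z 1) (nth 0 z 2)).
  apply: (E2_sum (f := fun z => Nat.testbit (nth 0 z 0) (nth 0 z 2)
                              * Nat.testbit (nth 0 z 1) (nth 0 z 2))).
    by apply: E2_mul; apply: E2_testbit; apply: E2_nth.
  by case=> -[|a [|c []]].
pose fs : seq (nfun 2) :=
  [:: fun z : 2.-tuple nat => nth 0 z 0; fun z : 2.-tuple nat => nth 0 z 1;
      fun z : 2.-tuple nat => nth 0 z 0].
have Efs (i : 'I_3) : E2 (nth (fun=> 0) fs i).
  by case: i => -[|[|[|//]]] _ /=; exact: E2_nth.
by apply: E2_ext (E2_comp EF Efs) => z; rewrite !nth_tuple_funs.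
Qed.

Lemma E2_Q : E2 (fun6 Q).
Proof.
have ER2 : E2 (fun2 R) by apply: E2_R; apply: E2_nth.
have [p poly_p le_p] := E2_bound ER2.
pose r (z : 7.-tuple nat) a c := R (nth 0 z a) (nth 0 z c * nth 0 z 5).
have Er a c : a < 7 -> c < 7 -> E2 (fun z => r z a c).
  move=> lt_a lt_c; apply: E2_R; first exact: E2_nth.
  by apply: E2_mul; apply: E2_nth.
(* Entry 5 is the time and entry 6 the previous value. The factor [1 - common_bits] is 1 exactly for
   disjoint numbers, and the majorant bounds each addend by its polynomial bound at the final
   time. *)
apply: (@E2_rec 5 (fun z => nth 0 z 0)
  (fun z => nth 0 z 6 + r z 2 4 * (1 - common_bits (nth 0 z 6) (r z 1 3)))
  (fun z => nth 0 z 0 + nth 0 z 5 * p (nth 0 z 2 + nth 0 z 4 * nth 0 z 5))).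
- exact: E2_nth.
- apply: E2_add; first exact: E2_nth.
  apply: E2_mul; first exact: Er.
  apply: E2_sub; first exact: E2_const.
  by apply: E2_common_bits; [apply: E2_nth | apply: Er].
- apply: E2_add; first exact: E2_nth.
  apply: E2_mul; first exact: E2_nth.
  apply: E2_poly => //; apply: E2_add; first exact: E2_nth.
  by apply: E2_mul; apply: E2_nth.
case=> -[|x [|p1 [|p2 [|c1 [|c2 []]]]]] // sz; rewrite /fun6 /r /=.
split=> // t; split.
  rewrite -common_bits_eq0; set q := Q _ _ _ _ _ _.
  by case: (common_bits q _) => [|k] /=; rewrite ?muln1 ?muln0 ?addn0.
have le_R y : R p2 y <= p (p2 + y).
  have := le_p [tuple p2; y]; rewrite /fun2 /= addn0; exact.
have {}le_R k : k <= t -> R p2 (c2 * k) <= p (p2 + c2 * t).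
  move=> le_kt; apply: leq_trans (le_R _) _; apply: poly_mono => //.
  by rewrite leq_add2l leq_mul2l le_kt orbT.
set P := p _ in le_R *.
suff claim k : k <= t -> Q x p1 p2 c1 c2 k <= x + k * P by exact: claim.
elim: k => [|k IH] le_kt /=; first exact: leq_addr.
have := IH (ltnW le_kt); have := le_R k (ltnW le_kt).
by case: ifP => _; lia.
Qed.

Theorem theorem4 : quasi_universal_E2 (superposition_closure arith_base) (fun6 Q).
Proof.
by split=> [|n f]; [exact: E2_Q | exact: E2_via_Q].
Qed.
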